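(* Fix $0\le\ell<u$ and $p>1$, and assume that $\xi_1\in(\ell,u)$ minimizes $\operatorname{vol}(\breve{U}^*_p(\ell,\xi_1,u))$ over $(\ell,u)$. Then: (i) if $p=2$, then $\xi_1=\frac{u+\ell}{2}$; (ii) if $1<p<2$, then $$\left(\frac{u^{p-1}+\ell^{p-1}}{2}\right)^{\frac1{p-1}}<\frac{(p-1)(u^p-\ell^p)}{p(u^{p-1}-\ell^{p-1})}<\xi_1<\left(\frac{u^p-\ell^p}{p(u-\ell)}\right)^{\frac1{p-1}}<\frac{u+\ell}{2};$$ (iii) if $p>2$, then $$\left(\frac{u^{p-1}+\ell^{p-1}}{2}\right)^{\frac1{p-1}}>\frac{(p-1)(u^p-\ell^p)}{p(u^{p-1}-\ell^{p-1})}>\xi_1>\left(\frac{u^p-\ell^p}{p(u-\ell)}\right)^{\frac1{p-1}}>\frac{u+\ell}{2}.$$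
   Context: Let $f(x):=x^p$ on $[\ell,u]$, and $(\xi_0,\xi_1,\xi_2):=(\ell,\xi_1,u)$ with $\ell<\xi_1<u$. For $i=1,2$ put $$\tau_i:=\frac{[f(\xi_i)-f'(\xi_i)\xi_i]-[f(\xi_{i-1})-f'(\xi_{i-1})\xi_{i-1}]}{f'(\xi_{i-1})-f'(\xi_i)},$$ the abscissa of the intersection of the tangent lines to $f$ at $\xi_{i-1}$ and $\xi_i$. Let $g:[\ell,u]\to\mathbb{R}$ be the piecewise-linear function whose graph connects, in order, $(\ell,f(\ell))$, the points $(\tau_i,\ f(\xi_i)+f'(\xi_i)(\tau_i-\xi_i))$ for $i=1,2$, and $(u,f(u))$. With $s:=\frac{f(u)-f(\ell)}{u-\ell}$, the set $\breve{U}^*_p(\ell,\xi_1,u)$ is the closure of the convex hull of $$\left\{(x,y,z)\in\mathbb{R}^3:\ (f(\ell)-s\ell)z+sx\ge y\ge z\,g(x/z),\ uz\ge x\ge \ell z,\ 1\ge z>0,\ y\ge 0\right\}.$$ $\operatorname{vol}$ denotes 3-dimensional volume. *)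

(* Defs.v *)
From HB Require Import structures.
From mathcomp Require Import all_boot all_order all_algebra.
From mathcomp Require Import all_classical all_reals all_analysis.

Set Implicit Arguments.
Unset Strict Implicit.
Unset Printing Implicit Defensive.

Import Order.TTheory GRing.Theory Num.Theory.
Import numFieldNormedType.Exports.

Local Open Scope classical_set_scope.
Local Open Scope ring_scope.

Definition convex_hull (R : numDomainType) (M : lmodType R) (A : set M) :
    set M :=
  \bigcap_(C in [set C | convex_set C /\ A `<=` C]) C.

Definition vol3 (R : realType) (A : set (R * R * R)) : \bar R :=
  ((@lebesgue_measure R \x @lebesgue_measure R) \x @lebesgue_measure R)%E A.

Definition segment_line (R : realType) (a b : R * R) (x : R) : R :=
  a.2 + (b.2 - a.2) / (b.1 - a.1) * (x - a.1).

(* Vertices are listed by increasing abscissa; the result is relevant only for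
   x between the first and the last abscissa. *)
Fixpoint polyline (R : realType) (a : R * R) (s : seq (R * R)) (x : R) : R :=
  match s with
  | [::] => a.2
  | b :: s' => if x <= b.1 then segment_line a b x else polyline b s' x
  end.

Section PowerRelaxation.
Variables (R : realType) (p : R).

Let f (x : R) : R := x `^ p.

(* f' on [0, +oo[.  An explicit formula is used because the library's powR is 1
   on negative numbers, so that at 0 only the right derivative makes sense.
   For 0 < x see is_derive1_powR, for x = 0 see dpow_right0. *)
Definition dpow (x : R) : R := p * x `^ (p - 1).

Lemma dpow_right0 : 1 < p ->
  (y `^ p - 0 `^ p) / (y - 0) @[y --> 0^'+] --> dpow 0.
Proof.
move=> p1; have p0 : 0 < p by exact: lt_trans p1.
have q0 : 0 < p - 1 by rewrite subr_gt0.
rewrite /dpow !powR0 ?gt_eqF// mulr0.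
apply: cvg_trans (powR_cvg0 q0); apply: near_eq_cvg; near=> y.
have y0 : 0 < y by [].
by rewrite !subr0 powRB ?(gt_eqF y0) ?implybT// powRr1// ltW.
Unshelve. all: end_near. Qed.

(* Abscissa of the intersection of the tangents to f at a and b. *)
Definition tau (a b : R) : R :=
  ((f b - dpow b * b) - (f a - dpow a * a)) / (dpow a - dpow b).

Definition tangent_vertex (a b : R) : R * R :=
  (tau a b, f b + dpow b * (tau a b - b)).

Definition under_estimator (l xi u : R) : R -> R :=
  polyline (l, f l)
    [:: tangent_vertex l xi; tangent_vertex xi u; (u, f u)].

Definition secant_slope (l u : R) : R := (f u - f l) / (u - l).

Definition U_points (l xi u : R) : set (R^o * R^o * R^o) :=
  [set w : R^o * R^o * R^o |
    let x : R := w.1.1 in let y : R := w.1.2 in let z : R := w.2 in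
    let s := secant_slope l u in
    [/\ z * under_estimator l xi u (x / z) <= y <= (f l - s * l) * z + s * x,
        l * z <= x <= u * z,
        0 < z <= 1
      & 0 <= y] ].

Definition breveU (l xi u : R) : set (R^o * R^o * R^o) :=
  closure (convex_hull (U_points l xi u)).

End PowerRelaxation.

(* Main.v *)
Require Import Defs.
From HB Require Import structures.
From mathcomp Require Import all_boot all_order all_algebra.
From mathcomp Require Import all_classical all_reals all_analysis.
From mathcomp Require Import measurable_realfun ring lra.

Import Order.TTheory GRing.Theory Num.Theory.
Import numFieldNormedType.Exports.
Local Open Scope classical_set_scope.
Local Open Scope ring_scope.

(** Write q = p - 1, so that the slope of the tangent at c is p c^q.

    Reduction to one equation.  For every choice of xi the relaxation is the
    truncated cone of the points (z x, z y, z) with 0 <= z <= 1 and (x, y) in the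
    polygon that lies between the chord of x^p and its tangents at l, xi
    and u ([breveU_frustum]); its volume is a third of the area of the polygon
    ([vol3_frustum]).  That area can be written for arbitrary breakpoints s1,
    s2 where one passes from one tangent to the next.  Moving the breakpoints
    away from the crossing points of the tangents adds a positive quadratic
    term ([cross_area_breakpoints]), and, the breakpoints t1, t2 being kept
    fixed, exchanging the middle tangent changes the area by (t2 - t1) times
    the difference of the two tangents at the middle m of [t1, t2]
    ([cross_area_middle]).  So take the breakpoints of a minimizer xi and
    replace the tangent at xi by the tangent at m: unless m = xi, the latter is
    strictly higher at m, and the area strictly decreases.  Hence
    tau l xi + tau xi u = 2 xi ([area_min_tau]), without any differentiation of
    the volume.

    The inequalities.  Everything is homogeneous, so one may scale the middle
    point to 1 and compare the two endpoints a < 1 < b.  Two gaps of the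
    function x^p matter: x^p - p x + q, the gap at x of the tangent at 1
    ([tan1_gap]), and q x^p - p x^q + 1, the gap at 1 of the tangent at x
    ([at1_gap]); moreover tau 1 x - 1 = at1_gap x / (p (x^q - 1)) ([offset]).
    Each of the four inequalities says which of the two endpoints has the
    larger gap.  Three of them follow from comparing tan1_gap with a quadratic
    function of x, and at1_gap with a quadratic function of x^q
    ([tan1_gap_quadratic], [at1_gap_quadratic]), which reduce to the Bernoulli
    inequality.

    The remaining one, xi < ((u^p - l^p) / (p (u - l)))^(1/q) when p < 2, says
    that tan1_gap a < tan1_gap b as soon as offset a = - offset b.  The two
    equalities tan1_gap a = tan1_gap b and offset a = - offset b coincide to
    leading order near a = b = 1, and quadratic models are too coarse.  Let e
    be the value of tan1_gap, taken as a coordinate on either side of 1.  Since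
    offset x = x - 1 - e dx/de, the derivative of the offset is - e d^2x/de^2,
    and this is e curv^(-3/2) up to a constant factor and the sign, where
    curv = (x^q - 1)^2 x^(2(1-q)/3).  In turn d curv/de and then its own
    derivative are explicit, and the last one is a constant times the
    monotone function x^(-(4+2q)/3).  Integrating three times in e compares the
    offset with sqrt (k e / (3q - c e)) for constants k and c, in opposite
    directions on the two sides of 1 ([curv_slope_sign], [curv_sign],
    [model_offset_sign], [tan1_gap_level]); equal offsets are then reached at
    different levels e.

    All comparisons change direction at p = 2.  They are stated with the factor
    1 - q = 2 - p, which treats both cases at once. *)

(** * Sign of a function that vanishes at 0 *)

Section OneVariable.
Context {R : realType}.
Implicit Types (F G dF : R -> R) (s c x q : R).

(** The hypotheses are confined to the segment from 0 to s, and differentiability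
    is not required at 0: below, F involves a square root that vanishes at 0 and
    whose argument need not stay meaningful beyond s. *)
Lemma mvt_from0 F dF s : s != 0 -> F 0 = 0 ->
    (forall c, 0 < c * s -> `|c| < `|s| -> is_derive c 1 F (dF c)) ->
    (forall c, 0 <= c * s -> `|c| <= `|s| -> {for c, continuous F}) ->
  exists c, [/\ 0 < c * s, `|c| < `|s| & F s = dF c * s].
Proof.
move=> s0 F0 dFE cF.
have [sgt0|slt0] := ltP 0 s.
  have [||c /[!in_itv]/= /andP[c0 cs] FE] := @MVT R F dF 0 s sgt0.
  - move=> c; rewrite in_itv/= => /andP[c0 cs].
    by apply: dFE; rewrite ?mulr_gt0// !gtr0_norm.
  - apply: continuous_in_subspaceT => c; rewrite inE/= in_itv/= => /andP[c0 cs].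
    by apply: cF; [rewrite mulr_ge0// ltW|rewrite !ger0_norm// ltW].
  - exists c; split; rewrite ?mulr_gt0// ?gtr0_norm//.
    by move: FE; rewrite F0 !subr0.
have {}slt0 : s < 0 by rewrite lt_neqAle s0.
have [||c /[!in_itv]/= /andP[c0 cs] FE] := @MVT R F dF s 0 slt0.
- move=> c; rewrite in_itv/= => /andP[sc c0].
  by apply: dFE; rewrite ?nmulr_lgt0// !ltr0_norm// ltrN2.
- apply: continuous_in_subspaceT => c; rewrite inE/= in_itv/= => /andP[sc c0].
  by apply: cF; [rewrite nmulr_lge0|rewrite !ler0_norm ?lerN2// ltW].
- exists c; split; rewrite ?nmulr_lgt0// ?ltr0_norm// ?ltrN2//.
  by move: FE; rewrite F0 !sub0r mulrN => /oppr_inj.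
Qed.

Lemma mvt_from0_smooth F dF s : s != 0 -> F 0 = 0 ->
    (forall c, is_derive c 1 F (dF c)) ->
  exists c, [/\ 0 < c * s, `|c| < `|s| & F s = dF c * s].
Proof.
move=> s0 F0 dFE; apply: mvt_from0 => // c _ _.
by apply/differentiable_continuous/derivable1_diffP; case: (dFE c).
Qed.

(** Multiplying by s records both signs of s in one inequality. *)
Lemma pos_of_derive_pos F dF s : s != 0 -> F 0 = 0 ->
  (forall c, is_derive c 1 F (dF c)) -> (forall c, c != 0 -> 0 < dF c) ->
  0 < s * F s.
Proof.
move=> s0 F0 dFE dF0; have [c [cs _ ->]] := mvt_from0_smooth _ _ _ s0 F0 dFE.
rewrite mulrCA mulr_gt0 ?dF0//; last by rewrite -expr2 lt_neqAle sqr_ge0 eq_sym sqrf_eq0 s0.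
by apply: contraTneq cs => ->; rewrite mul0r ltxx.
Qed.

Lemma pos_of_derive_sign F dF s : s != 0 -> F 0 = 0 ->
  (forall c, is_derive c 1 F (dF c)) -> (forall c, c != 0 -> 0 < c * dF c) ->
  0 < F s.
Proof.
move=> s0 F0 dFE dF0; have [c [cs _ ->]] := mvt_from0_smooth _ _ _ s0 F0 dFE.
have c0 : c != 0 by apply: contraTneq cs => ->; rewrite mul0r ltxx.
rewrite -(pmulr_rgt0 _ cs).
have := mulr_gt0 (dF0 _ c0) (_ : 0 < s ^+ 2).
rewrite lt_neqAle sqr_ge0 eq_sym sqrf_eq0 s0 => /(_ isT).
by rewrite (_ : c * dF c * _ = c * s * (dF c * s))//; ring.
Qed.

Lemma same_sign_trans (x y z : R) : 0 < x * y -> 0 < x * z -> 0 < y * z.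
Proof.
move=> xy xz; have := mulr_gt0 xy xz.
rewrite (_ : x * y * (x * z) = x ^+ 2 * (y * z)); last by ring.
by apply: contraTT; rewrite -!leNgt => ?; rewrite mulr_ge0_le0// sqr_ge0.
Qed.

(** * The gaps in exponential coordinates *)

Definition expk k s : R := expR (k * s).

Lemma is_derive_expk k s : is_derive s 1 (expk k) (k * expk k s).
Proof. by apply: is_derive_eq; rewrite [LHS]mulrC /GRing.scale/= mulr1. Qed.

Hint Extern 0 (is_derive _ _ (expk _) _) => exact: is_derive_expk : typeclass_instances.

Lemma expk0 k : expk k 0 = 1. Proof. by rewrite /expk mulr0 expR0. Qed.
Lemma expk_gt0 k s : 0 < expk k s. Proof. exact: expR_gt0. Qed.
Lemma expk_neq0 k s : expk k s != 0. Proof. by rewrite gt_eqF ?expk_gt0. Qed.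
Lemma expkN k s : expk (- k) s = (expk k s)^-1.
Proof. by rewrite /expk mulNr expRN. Qed.
Lemma expkX k s n : expk k s ^+ n = expk (n%:R * k) s.
Proof. by rewrite /expk -expRM_natl mulrA. Qed.
Lemma expkD k k' s : expk (k + k') s = expk k s * expk k' s.
Proof. by rewrite /expk mulrDl expRD. Qed.

Lemma expR_sub1_sign x : x != 0 -> 0 < x * (expR x - 1).
Proof.
case: (ltgtP x 0) => // x0 _.
  by rewrite nmulr_rgt0// subr_lt0 expR_lt1.
by rewrite mulr_gt0// subr_gt0 expR_gt1.
Qed.

Lemma expk_sub1_sign k s : 0 < k -> s != 0 -> 0 < s * (expk k s - 1).
Proof.
move=> k0 s0; rewrite -(pmulr_rgt0 _ k0) mulrA; apply: expR_sub1_sign.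
by rewrite mulf_neq0// gt_eqF.
Qed.

Ltac derive_exp := apply: is_derive_eq; rewrite ?fctE /GRing.scale/=.

Lemma is_derive_comb F G s (df dg k c d : R) :
    is_derive s 1 F df -> is_derive s 1 G dg ->
  is_derive s 1 (fun t => k * (F t + c * G t - d)) (k * (df + c * dg)).
Proof.
move=> dF dG.
have dcG : is_derive s 1 (fun t => c * G t) (c * dg) by exact: is_deriveZ.
have := is_deriveZ k (is_deriveB (is_deriveD dF dcG) (is_derive_cst d s 1)).
by rewrite subr0.
Qed.

Lemma is_derive_quot F G s (df dg : R) :
    is_derive s 1 F df -> is_derive s 1 G dg -> G s != 0 ->
  is_derive s 1 (fun t => F t / G t) ((df * G s - F s * dg) / G s ^+ 2).
Proof.
move=> dF dG Gs; have := is_deriveM dF (is_deriveV Gs dG).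
rewrite /GRing.scale/= => dFG; apply: (is_derive_eq dFG).
by field.
Qed.

(** With x = e^(3s), the quantities x, x^q and x^((q-1)/3) are monomials in
    w = e^s and a = e^(qs) (and their inverses u, b), so that every derivative
    below is an identity between rational functions of w and a. *)
Section gap.
Variable q : R.
Hypothesis q0 : 0 < q.
Hypothesis q1 : q != 1.
Local Notation w := (expk 1).
Local Notation a := (expk q).
Local Notation u := (expk (-1)).
Local Notation b := (expk (-q)).

Let p_neq0 : 1 + q != 0. Proof. by rewrite gt_eqF// addr_gt0. Qed.
Let q_neq0 : q != 0. Proof. by rewrite gt_eqF. Qed.
Let q1sqr : 0 < (1 - q) ^+ 2.
Proof. by rewrite lt_neqAle sqr_ge0 eq_sym sqrf_eq0 subr_eq0 eq_sym q1. Qed.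

Let w3_sign s : s != 0 -> 0 < s * (w s ^+ 3 - 1).
Proof. by move=> s0; rewrite expkX expk_sub1_sign// mulr1. Qed.
Let a3_sign s : s != 0 -> 0 < s * (a s ^+ 3 - 1).
Proof. by move=> s0; rewrite expkX expk_sub1_sign// mulr_gt0. Qed.

Definition tan1_gap_e s := w s ^+ 3 * a s ^+ 3 - (1 + q) * w s ^+ 3 + q.

Lemma is_derive_tan1_gap_e s :
  is_derive s 1 tan1_gap_e (3 * (1 + q) * w s ^+ 3 * (a s ^+ 3 - 1)).
Proof.
rewrite (_ : tan1_gap_e = w ^+ 3 * a ^+ 3 - (1 + q) *: w ^+ 3 + cst q)//.
derive_exp; ring.
Qed.
Hint Extern 0 (is_derive _ _ tan1_gap_e _) => exact: is_derive_tan1_gap_e : typeclass_instances.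

Let tan1_gap_e0 : tan1_gap_e 0 = 0. Proof. by rewrite /tan1_gap_e !expk0; ring. Qed.

Lemma tan1_gap_e_gt0 s : s != 0 -> 0 < tan1_gap_e s.
Proof.
move=> s0; apply: (pos_of_derive_sign _ _ _ s0 tan1_gap_e0 is_derive_tan1_gap_e) => c c0.
rewrite mulrCA; apply: mulr_gt0; last exact: a3_sign.
by rewrite !mulr_gt0 ?addr_gt0 ?exprn_gt0 ?expk_gt0.
Qed.

Definition at1_gap_e s := q * w s ^+ 3 * a s ^+ 3 - (1 + q) * a s ^+ 3 + 1.

Lemma is_derive_at1_gap_e s :
  is_derive s 1 at1_gap_e (3 * (1 + q) * q * a s ^+ 3 * (w s ^+ 3 - 1)).
Proof.
rewrite (_ : at1_gap_e = q *: w ^+ 3 * a ^+ 3 - (1 + q) *: a ^+ 3 + cst 1)//.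
derive_exp; ring.
Qed.
Hint Extern 0 (is_derive _ _ at1_gap_e _) => exact: is_derive_at1_gap_e : typeclass_instances.

Let at1_gap_e0 : at1_gap_e 0 = 0. Proof. by rewrite /at1_gap_e !expk0; ring. Qed.

Lemma at1_gap_e_gt0 s : s != 0 -> 0 < at1_gap_e s.
Proof.
move=> s0; apply: (pos_of_derive_sign _ _ _ s0 at1_gap_e0 is_derive_at1_gap_e) => c c0.
rewrite mulrCA; apply: mulr_gt0; last exact: w3_sign.
by rewrite !mulr_gt0 ?addr_gt0 ?exprn_gt0 ?expk_gt0.
Qed.

Definition bernoulli_gap s := q * (w s ^+ 3 - 1) - (a s ^+ 3 - 1).

(** The Bernoulli inequality x^q - 1 < q (x - 1) for q < 1, reversed for q > 1:
    the derivative of the gap has the sign of x - x^q. *)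
Lemma bernoulli_gap_sign s : s != 0 -> 0 < (1 - q) * bernoulli_gap s.
Proof.
move=> s0; apply: (@pos_of_derive_sign (fun s => (1 - q) * bernoulli_gap s)
  (fun s => (1 - q) * (3 * q * (w s ^+ 3 - a s ^+ 3)))) => //.
- by rewrite /bernoulli_gap !expk0; ring.
- move=> c; rewrite (_ : (fun _ => _) =
    (1 - q) *: (q *: (w ^+ 3 - cst 1) - (a ^+ 3 - cst 1)))//.
  derive_exp; ring.
- move=> c c0.
  have k0 : (3 * (1 - q)) * c != 0.
    by rewrite !mulf_neq0// subr_eq0 eq_sym.
  have := expR_sub1_sign _ k0; rewrite -[expR _]/(expk _ _) => k1.
  have -> : w c ^+ 3 = expk (3 * (1 - q)) c * a c ^+ 3.
    by rewrite !expkX -expkD (_ : 3 * (1 - q) + 3 * q = 3 * 1)//; ring.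
  rewrite (_ : c * _ =
    q * a c ^+ 3 * (3 * (1 - q) * c * (expk (3 * (1 - q)) c - 1))); last by ring.
  by apply: mulr_gt0 k1; rewrite mulr_gt0// exprn_gt0// expk_gt0.
Qed.

(** The quadratic function has the second order jet of the gap at x = 1, and
    the derivative of the difference is a positive multiple of the Bernoulli
    gap. *)
Lemma tan1_gap_e_quadratic s : s != 0 ->
  0 < s * ((1 - q) * ((1 + q) * q / 2 * (w s ^+ 3 - 1) ^+ 2 - tan1_gap_e s)).
Proof.
move=> s0; apply: (@pos_of_derive_pos (fun s => (1 - q) *
    ((1 + q) * q / 2 * (w s ^+ 3 - 1) ^+ 2 - tan1_gap_e s))
  (fun s => 3 * (1 + q) * w s ^+ 3 * ((1 - q) * bernoulli_gap s))) => //.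
- by rewrite tan1_gap_e0 expk0; ring.
- move=> c; rewrite (_ : (fun _ => _) = (1 - q) *:
    (((1 + q) * q / 2) *: (w ^+ 3 - cst 1) ^+ 2 - tan1_gap_e))//.
  by derive_exp; rewrite /bernoulli_gap; field.
- move=> c c0; apply: mulr_gt0 (bernoulli_gap_sign _ c0).
  by rewrite !mulr_gt0 ?addr_gt0 ?exprn_gt0 ?expk_gt0.
Qed.

Lemma at1_gap_e_quadratic s : s != 0 ->
  0 < s * ((1 - q) * (at1_gap_e s - (1 + q) / (2 * q) * (a s ^+ 3 - 1) ^+ 2)).
Proof.
move=> s0; apply: (@pos_of_derive_pos (fun s => (1 - q) *
    (at1_gap_e s - (1 + q) / (2 * q) * (a s ^+ 3 - 1) ^+ 2))
  (fun s => 3 * (1 + q) * a s ^+ 3 * ((1 - q) * bernoulli_gap s))) => //.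
- by rewrite at1_gap_e0 expk0; ring.
- move=> c; rewrite (_ : (fun _ => _) = (1 - q) *:
    (at1_gap_e - ((1 + q) / (2 * q)) *: (a ^+ 3 - cst 1) ^+ 2))//.
  by derive_exp; rewrite /bernoulli_gap; field.
- move=> c c0; apply: mulr_gt0 (bernoulli_gap_sign _ c0).
  by rewrite !mulr_gt0 ?addr_gt0 ?exprn_gt0 ?expk_gt0.
Qed.

(** Up to the factor 2 / (3p), the derivative of [curv] with respect to the
    level e = tan1_gap. *)
Definition curv_slope s := ((1 + 2 * q) * a s ^+ 3 - (1 - q)) * (u s * b s ^+ 2).

Definition curv_coef := (1 + 2 * q) * (1 - q) / (3 * (1 + q)).

Lemma is_derive_curv_slope s : is_derive s 1 curv_slope
  ((1 + 2 * q) * (1 - q) * (1 - a s ^+ 3) * (u s * b s ^+ 2)).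
Proof.
rewrite (_ : curv_slope = ((1 + 2 * q) *: a ^+ 3 - cst (1 - q)) * (u * b ^+ 2))//.
by derive_exp; ring.
Qed.

Let curv_slope0 : curv_slope 0 = 3 * q.
Proof. by rewrite /curv_slope !expk0; ring. Qed.

(** The derivative of curv_slope with respect to the level is
    - curv_coef x^(-(4+2q)/3), which is compared with its value at x = 1. *)
Lemma curv_slope_sign s : s != 0 ->
  0 < s * ((1 - q) * (curv_slope s + curv_coef * tan1_gap_e s - 3 * q)).
Proof.
move=> s0; apply: (@pos_of_derive_pos (fun s => (1 - q) *
    (curv_slope s + curv_coef * tan1_gap_e s - 3 * q)) (fun s => (1 - q) ^+ 2 * (1 + 2 * q) *
   ((a s ^+ 3 - 1) * (w s ^+ 3 - u s * b s ^+ 2)))) => //.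
- by rewrite curv_slope0 tan1_gap_e0; ring.
- move=> c; have := is_derive_comb _ _ _ _ _ (1 - q) curv_coef (3 * q)
    (is_derive_curv_slope c) (is_derive_tan1_gap_e c).
  by congr is_derive; rewrite /curv_coef; field.
- move=> c c0.
  have wa : 0 < c * (w c ^+ 3 - u c * b c ^+ 2).
    rewrite (_ : _ - _ = u c * b c ^+ 2 * (w c ^+ 4 * a c ^+ 2 - 1)); last first.
      by rewrite !expkN; field; rewrite !expk_neq0.
    rewrite mulrCA; apply: mulr_gt0; first by rewrite mulr_gt0 ?exprn_gt0 ?expk_gt0.
    by rewrite !expkX -expkD expk_sub1_sign// addr_gt0// mulr_gt0.
  apply: mulr_gt0 (same_sign_trans _ _ _ (a3_sign _ c0) wa).
  by rewrite mulr_gt0// addr_gt0// mulr_gt0.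
Qed.

(** This is (x^q - 1)^2 x^(2(1-q)/3).  Its power -3/2 is the second derivative
    of x with respect to the level, up to sign and a constant factor. *)
Definition curv s := (a s ^+ 3 - 1) ^+ 2 * (w s ^+ 2 * b s ^+ 2).

(** The quadratic polynomial of the level that results from integrating the
    affine model 3q - curv_coef e of curv_slope. *)
Definition curv_model s :=
  2 / (3 * (1 + q)) * (tan1_gap_e s * (3 * q - curv_coef / 2 * tan1_gap_e s)).

Lemma curv_sign s : s != 0 -> 0 < s * ((1 - q) * (curv s - curv_model s)).
Proof.
move=> s0; apply: (@pos_of_derive_pos (fun s => (1 - q) * (curv s - curv_model s))
  (fun s => 2 * w s ^+ 3 * ((a s ^+ 3 - 1) * ((1 - q) *
     (curv_slope s + curv_coef * tan1_gap_e s - 3 * q))))) => //.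
- by rewrite /curv /curv_model tan1_gap_e0 !expk0; ring.
- move=> c; rewrite (_ : (fun _ => _) = (1 - q) *:
   ((a ^+ 3 - cst 1) ^+ 2 * (w ^+ 2 * b ^+ 2) -
    (2 / (3 * (1 + q))) *: (tan1_gap_e * (cst (3 * q) - (curv_coef / 2) *: tan1_gap_e))))//.
  derive_exp; rewrite /curv_slope !expkN; field.
  by rewrite !expk_neq0 p_neq0.
- move=> c c0.
  have aw := same_sign_trans _ _ _ (a3_sign _ c0) (curv_slope_sign _ c0).
  by apply: mulr_gt0 aw; rewrite mulr_gt0 ?exprn_gt0 ?expk_gt0.
Qed.

Definition lin_e s := 3 * q - curv_coef / 2 * tan1_gap_e s.
Definition level_coef := 3 / (2 * (1 + q)).

(** This is tau 1 x - 1, the abscissa of the crossing point of the tangents at 1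
    and x, measured from 1. *)
Definition offset_e s := at1_gap_e s / ((1 + q) * (a s ^+ 3 - 1)).

(** The square of the offset that results from replacing curv by curv_model. *)
Definition model_sqr s := level_coef * tan1_gap_e s / lin_e s.

Let level_coef_gt0 : 0 < level_coef. Proof. by rewrite divr_gt0// mulr_gt0// addr_gt0. Qed.
Let a3_neq1 s : s != 0 -> a s ^+ 3 - 1 != 0.
Proof. by move=> /a3_sign; apply: contraTneq => ->; rewrite mulr0 ltxx. Qed.

Lemma is_derive_offset s : s != 0 ->
  is_derive s 1 offset_e (3 * q * tan1_gap_e s * a s ^+ 3 / ((1 + q) * (a s ^+ 3 - 1) ^+ 2)).
Proof.
move=> s0.
have dA : is_derive s 1 (fun t => (1 + q) * (a t ^+ 3 - 1)) ((1 + q) * (3 * q * a s ^+ 3)).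
  rewrite (_ : (fun _ => _) = (1 + q) *: (a ^+ 3 - cst 1))//.
  by derive_exp; ring.
have A0 : (1 + q) * (a s ^+ 3 - 1) != 0 by rewrite mulf_neq0 ?a3_neq1.
have := is_derive_quot _ _ _ _ _ (is_derive_at1_gap_e s) dA A0.
congr is_derive; rewrite /at1_gap_e /tan1_gap_e; field.
by rewrite p_neq0 a3_neq1.
Qed.

Lemma is_derive_lin_e s :
  is_derive s 1 lin_e (- (curv_coef / 2 * (3 * (1 + q) * w s ^+ 3 * (a s ^+ 3 - 1)))).
Proof.
rewrite (_ : lin_e = cst (3 * q) - (curv_coef / 2) *: tan1_gap_e)//.
by derive_exp; rewrite sub0r.
Qed.

Lemma is_derive_model_sqr s : lin_e s != 0 ->
  is_derive s 1 model_sqr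
    (3 * q * level_coef * (3 * (1 + q) * w s ^+ 3 * (a s ^+ 3 - 1)) / lin_e s ^+ 2).
Proof.
move=> h0.
have dE : is_derive s 1 (fun t => level_coef * tan1_gap_e t)
    (level_coef * (3 * (1 + q) * w s ^+ 3 * (a s ^+ 3 - 1))).
  exact: is_deriveZ.
have := is_derive_quot _ _ _ _ _ dE (is_derive_lin_e s) h0.
by congr is_derive; congr (_ / _); rewrite /lin_e; ring.
Qed.

(** The level increases when x moves away from 1, so positivity of this affine
    function of the level propagates towards 1. *)
Lemma lin_e_gt0_between s c : 0 < lin_e s -> 0 <= c * s -> `|c| <= `|s| -> 0 < lin_e c.
Proof.
move=> hs cs lcs.
have [s0|s0] := eqVneq s 0.
  by move: lcs hs; rewrite s0 normr0 normr_le0 => /eqP ->.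
have [c0|c0] := eqVneq c 0.
  by rewrite c0 /lin_e tan1_gap_e0 mulr0 subr0 mulr_gt0.
have Ec := tan1_gap_e_gt0 _ c0.
have [C0|C0] := ltP curv_coef 0.
  rewrite /lin_e subr_gt0; apply: (@lt_trans _ _ 0); last by rewrite mulr_gt0.
  by rewrite pmulr_llt0// pmulr_llt0.
suff Ecs : tan1_gap_e c <= tan1_gap_e s.
  apply: lt_le_trans hs _; rewrite /lin_e lerD2l lerN2.
  by rewrite ler_wpM2l// divr_ge0.
have [sgt0|] := ltP 0 s.
  have cgt0 : 0 < c by rewrite lt_neqAle eq_sym c0 -(pmulr_lge0 _ sgt0).
  rewrite !gtr0_norm// in lcs.
  have [|d /[!in_itv]/= /andP[cd ds] dE] :=
      @MVT_segment R tan1_gap_e _ c s lcs (fun x _ => is_derive_tan1_gap_e x).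
    apply: continuous_subspaceT => x.
    by apply/differentiable_continuous/derivable1_diffP; case: (is_derive_tan1_gap_e x).
  have d0 : 0 < d by exact: lt_le_trans cd.
  rewrite -subr_ge0 dE mulr_ge0 ?subr_ge0//.
  rewrite mulr_ge0//; last first.
    by rewrite -(pmulr_rge0 _ d0) ltW// a3_sign// gt_eqF.
  by rewrite !mulr_ge0 ?exprn_ge0 ?addr_ge0// ltW// expk_gt0.
rewrite le_eqVlt (negbTE s0)/= => slt0.
have clt0 : c < 0 by rewrite lt_neqAle c0 -(nmulr_lge0 _ slt0).
rewrite !ltr0_norm// lerN2 in lcs.
have [|d /[!in_itv]/= /andP[cd ds] dE] :=
    @MVT_segment R tan1_gap_e _ s c lcs (fun x _ => is_derive_tan1_gap_e x).
  apply: continuous_subspaceT => x.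
  by apply/differentiable_continuous/derivable1_diffP; case: (is_derive_tan1_gap_e x).
have d0 : d < 0 by exact: le_lt_trans clt0.
rewrite -subr_le0 dE mulr_le0_ge0 ?subr_ge0//.
rewrite mulr_ge0_le0//; last first.
  by rewrite -(nmulr_rge0 _ d0) ltW// a3_sign// lt_eqF.
by rewrite !mulr_ge0 ?exprn_ge0 ?addr_ge0// ltW// expk_gt0.
Qed.

Lemma offset_sign s : s != 0 -> 0 < s * offset_e s.
Proof.
move=> s0; have sa := a3_sign _ s0.
rewrite /offset_e (_ : _ * _ = at1_gap_e s * (s ^+ 2 / (1 + q) / (s * (a s ^+ 3 - 1)))); last first.
  by field; rewrite ?s0 ?p_neq0 ?a3_neq1.
rewrite mulr_gt0 ?at1_gap_e_gt0// divr_gt0// divr_gt0 ?addr_gt0//.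
by rewrite lt_neqAle sqr_ge0 eq_sym sqrf_eq0 s0.
Qed.

(** The crossing point of the tangents at 1 and x lies between 1 and x; this
    gives the continuity of the offset at its removable singularity. *)
Lemma offset_le s : `|offset_e s| <= `|w s ^+ 3 - 1|.
Proof.
have [->|s0] := eqVneq s 0.
  by rewrite /offset_e at1_gap_e0 mul0r !expk0 expr1n subrr.
have e0 := offset_sign _ s0; have w0 := w3_sign _ s0.
have : 0 < s * (w s ^+ 3 - 1 - offset_e s).
  have sa := a3_sign _ s0.
  rewrite /offset_e (_ : _ * _ = tan1_gap_e s * (s ^+ 2 / (1 + q) / (s * (a s ^+ 3 - 1)))).
    rewrite mulr_gt0 ?tan1_gap_e_gt0// divr_gt0// divr_gt0 ?addr_gt0//.
    by rewrite lt_neqAle sqr_ge0 eq_sym sqrf_eq0 s0.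
  by rewrite /at1_gap_e /tan1_gap_e; field; rewrite ?s0 ?p_neq0 ?a3_neq1.
rewrite mulrBr subr_gt0 => le.
rewrite -(ler_pM2l (_ : 0 < `|s|)) ?normr_gt0// -!normrM.
by rewrite !gtr0_norm// ltW.
Qed.

Lemma continuous_offset : continuous offset_e.
Proof.
move=> s; have [->|s0] := eqVneq s 0; last first.
  by apply/differentiable_continuous/derivable1_diffP; case: (is_derive_offset _ s0).
have offset0 : offset_e 0 = 0 by rewrite /offset_e at1_gap_e0 mul0r.
suff : offset_e x @[x --> (0:R)] --> (0:R) by rewrite -[X in _ --> X]offset0.
have w30 : `|w x ^+ 3 - 1| @[x --> 0] --> (0:R).
  have dw : is_derive (0:R) 1 (fun x => w x ^+ 3 - 1) (3 * w 0 ^+ 3).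
    rewrite (_ : (fun _ => _) = w ^+ 3 - cst 1)//.
    by derive_exp; ring.
  have : {for (0:R), continuous (fun x => w x ^+ 3 - 1)}.
    by apply/differentiable_continuous/derivable1_diffP; case: dw.
  move/cvg_norm; rewrite expk0 expr1n subrr normr0; exact.
apply/norm_cvg0P.
apply: (squeeze_cvgr _ (cvg_cst _) w30).
by near=> x; rewrite normr_ge0 offset_le.
Unshelve. all: end_near. Qed.

(** With respect to the level e, the offset and its model have derivatives
    e curv^(-3/2) and e curv_model^(-3/2), up to the same constant and the sign,
    so that the order of curv and curv_model decides. *)
Lemma model_offset_sign s : s != 0 -> 0 < lin_e s ->
  0 < (1 - q) * (Num.sg s * Num.sqrt (model_sqr s) - offset_e s).
Proof.
move=> s0 hs.
pose F t := (1 - q) * (Num.sg s * Num.sqrt (model_sqr t) - offset_e t).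
have hc c : 0 <= c * s -> `|c| <= `|s| -> 0 < lin_e c by exact: lin_e_gt0_between.
(* The derivatives of model_sqr, of the model offset and of the offset. *)
pose dth t := 3 * q * level_coef * (3 * (1 + q) * w t ^+ 3 * (a t ^+ 3 - 1)) / lin_e t ^+ 2.
pose X t := Num.sg s * ((2 * Num.sqrt (model_sqr t))^-1 * dth t).
pose Y t := 3 * q * tan1_gap_e t * a t ^+ 3 / ((1 + q) * (a t ^+ 3 - 1) ^+ 2).
have model_sqr_gt0 t : t != 0 -> 0 < lin_e t -> 0 < model_sqr t.
  by move=> t0 ht; rewrite /model_sqr divr_gt0// mulr_gt0 ?tan1_gap_e_gt0.
have [|c cs lcs|c cs lcs|c [cs lcs]] :=
    @mvt_from0 F (fun t => (1 - q) * (X t - Y t)) s s0.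
- by rewrite /F /model_sqr /offset_e tan1_gap_e0 at1_gap_e0 mulr0 !mul0r sqrtr0 mulr0 subr0 mulr0.
- have c0 : c != 0 by apply: contraTneq cs => ->; rewrite mul0r ltxx.
  have hc0 : 0 < lin_e c by apply: hc; exact: ltW.
  have dT : is_derive c 1 (Num.sqrt \o model_sqr) ((2 * Num.sqrt (model_sqr c))^-1 * dth c).
    apply: is_derive1_comp; first exact/is_derive1_sqrt/model_sqr_gt0.
    by apply: is_derive_model_sqr; rewrite gt_eqF.
  exact: (is_deriveZ (1 - q)
    (is_deriveB (is_deriveZ (Num.sg s) dT) (is_derive_offset _ c0))).
- have hc0 : 0 < lin_e c by exact: hc.
  have cT : {for c, continuous (Num.sqrt \o model_sqr)}.
    apply: continuous_comp; last exact: sqrt_continuous.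
    apply/differentiable_continuous/derivable1_diffP.
    by case: (is_derive_model_sqr c _); rewrite ?gt_eqF.
  apply: continuousM; first exact: cst_continuous.
  apply: continuousB; last exact: continuous_offset.
  by apply: continuousM; first exact: cst_continuous.
rewrite /F => ->.
have c0 : c != 0 by apply: contraTneq cs => ->; rewrite mul0r ltxx.
have hc0 : 0 < lin_e c by apply: hc; exact: ltW.
have E0 := tan1_gap_e_gt0 _ c0; have A0 := a3_neq1 _ c0; have t0 := model_sqr_gt0 _ c0 hc0.
have A2 : 0 < (a c ^+ 3 - 1) ^+ 2 by rewrite lt_neqAle sqr_ge0 eq_sym sqrf_eq0 A0.
have Y0 : 0 < Y c.
  apply: divr_gt0; last by rewrite mulr_gt0// addr_gt0.
  by rewrite !mulr_gt0 ?exprn_gt0 ?expk_gt0.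
have X0 : 0 < X c.
  rewrite (_ : X c = (2 * Num.sqrt (model_sqr c))^-1 * (3 * q * level_coef *
     (3 * (1 + q) * w c ^+ 3) / lin_e c ^+ 2) * (Num.sg s * (a c ^+ 3 - 1)));
    last by rewrite /X /dth; ring.
  apply: mulr_gt0.
    apply: mulr_gt0; first by rewrite invr_gt0 mulr_gt0 ?sqrtr_gt0.
    apply: divr_gt0; last exact: exprn_gt0.
    have kq : 0 < 3 * q * level_coef by rewrite mulr_gt0// mulr_gt0.
    by apply: mulr_gt0 kq _; rewrite !mulr_gt0 ?addr_gt0 ?exprn_gt0 ?expk_gt0.
  rewrite -(pmulr_rgt0 _ (_ : 0 < `|s|)) ?normr_gt0// mulrA [`|s| * _]mulrC -numEsg.
  exact: same_sign_trans cs (a3_sign _ c0).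
suff : 0 < c * ((1 - q) * (X c ^+ 2 - Y c ^+ 2)).
  rewrite (_ : c * _ = c * ((1 - q) * (X c - Y c)) * (X c + Y c)); last by ring.
  rewrite pmulr_lgt0 ?addr_gt0// => cXY.
  by rewrite mulrC; exact: same_sign_trans cs cXY.
(* Squaring removes the root and leaves a difference of third powers. *)
have JE : X c ^+ 2 - Y c ^+ 2 = 9 * q ^+ 2 * a c ^+ 6 * 27 * (1 + q) /
    (8 * tan1_gap_e c * lin_e c ^+ 3 * (a c ^+ 3 - 1) ^+ 4) * (curv c ^+ 3 - curv_model c ^+ 3).
  rewrite {1}/X exprMn sqr_sg s0 mul1r exprMn exprVn exprMn sqr_sqrtr ?(ltW t0)//.
  rewrite /dth /model_sqr /Y /curv /curv_model !expkN -/(lin_e c) /level_coef; field.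
  by rewrite !expk_neq0 p_neq0 A0 !gt_eqF.
have J0 : 0 < curv c.
  by apply: mulr_gt0; rewrite // mulr_gt0 ?exprn_gt0 ?expk_gt0.
have T0 : 0 < curv_model c.
  apply: mulr_gt0; last exact: mulr_gt0.
  by rewrite divr_gt0// mulr_gt0// addr_gt0.
rewrite JE (_ : c * _ = 9 * q ^+ 2 * a c ^+ 6 * 27 * (1 + q) /
    (8 * tan1_gap_e c * lin_e c ^+ 3 * (a c ^+ 3 - 1) ^+ 4) *
   (curv c ^+ 2 + curv c * curv_model c + curv_model c ^+ 2) *
   (c * ((1 - q) * (curv c - curv_model c)))); last by ring.
apply: mulr_gt0 (curv_sign _ c0); apply: mulr_gt0; last first.
  by rewrite !addr_gt0// ?exprn_gt0// mulr_gt0.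
have A4 : 0 < (a c ^+ 3 - 1) ^+ 4.
  by rewrite (exprM _ 2 2) exprn_gt0.
apply: divr_gt0; first by rewrite !mulr_gt0 ?exprn_gt0 ?expk_gt0 ?addr_gt0.
by apply: mulr_gt0 A4; rewrite mulr_gt0 ?exprn_gt0 ?mulr_gt0.
Qed.

Lemma level_sign s : s != 0 -> 0 < lin_e s ->
  0 < s * ((1 - q) * (level_coef * tan1_gap_e s - offset_e s ^+ 2 * lin_e s)).
Proof.
move=> s0 hs; have T := model_offset_sign _ s0 hs.
have t0 : 0 <= model_sqr s.
  by rewrite /model_sqr divr_ge0 ?(ltW hs)// mulr_ge0 ?ltW ?tan1_gap_e_gt0.
have -> : level_coef * tan1_gap_e s = Num.sqrt (model_sqr s) ^+ 2 * lin_e s.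
  by rewrite sqr_sqrtr// /model_sqr divfK// gt_eqF.
set t := Num.sqrt _ in T *.
have sg2 : Num.sg s ^+ 2 = 1 by rewrite sqr_sg s0.
have P : 0 < s * (Num.sg s * t + offset_e s).
  rewrite mulrDr ltr_wpDl ?offset_sign// mulrA [s * _]mulrC -normrEsg.
  by rewrite mulr_ge0 ?normr_ge0 ?sqrtr_ge0.
have := mulr_gt0 hs (mulr_gt0 T P); congr (0 < _).
transitivity (s * ((1 - q) * (Num.sg s ^+ 2 * t ^+ 2 * lin_e s - offset_e s ^+ 2 * lin_e s))).
  by ring.
by rewrite sg2 mul1r.
Qed.

End gap.
End OneVariable.

(** * The gaps on the nonnegative half-line *)

(** Here n is the common square of the offsets.  For c > 0 the comparison at e'
    is available only as long as 3 q - c e' is positive; otherwise e' is already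
    beyond 3 q / c, whereas e is not. *)
Lemma level_order {R : realDomainType} (q k n c e e' : R) :
    0 < q -> q != 1 -> 0 < k -> 0 < n -> 0 < e -> 0 < e' ->
    c < 1 -> 0 < (1 - q) * c -> (q < 1 -> e <= q) ->
    (0 < 3 * q - c * e -> (1 - q) * (k * e - n * (3 * q - c * e)) < 0) ->
    (0 < 3 * q - c * e' -> 0 < (1 - q) * (k * e' - n * (3 * q - c * e'))) ->
  0 < (1 - q) * (e' - e).
Proof.
move=> q0 q1 k0 n0 e0 e0' c1 cq eq Ha Hb.
have [q_lt1|q_gt1|/eqP] := ltgtP q 1; last by rewrite (negbTE q1).
- have c0 : 0 < c by rewrite pmulr_rgt0 ?subr_gt0// in cq.
  have {eq} eq := eq q_lt1.
  have ha : 0 < 3 * q - c * e.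
    have : 0 < (1 - c) * e by rewrite mulr_gt0// subr_gt0.
    lra.
  rewrite pmulr_rgt0 ?subr_gt0//.
  have {Ha} := Ha ha; rewrite pmulr_rlt0 ?subr_gt0// subr_lt0 => Ha.
  have [hb|hb] := ltP 0 (3 * q - c * e'); last first.
    by rewrite -(ltr_pM2l c0); lra.
  have {Hb} := Hb hb; rewrite pmulr_rgt0 ?subr_gt0// => Hb.
  have kc : 0 < k + n * c by rewrite addr_gt0// mulr_gt0.
  by rewrite -(ltr_pM2l kc); lra.
- have c0 : c < 0 by rewrite nmulr_rgt0 ?subr_lt0// in cq.
  have ce : c * e < 0 by rewrite pmulr_llt0.
  have ce' : c * e' < 0 by rewrite pmulr_llt0.
  have ha : 0 < 3 * q - c * e by lra.
  have hb : 0 < 3 * q - c * e' by lra.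
  rewrite nmulr_rgt0 ?subr_lt0//.
  have {Ha} := Ha ha; rewrite nmulr_rlt0 ?subr_lt0// subr_gt0 => Ha.
  have {Hb} := Hb hb; rewrite nmulr_rgt0 ?subr_lt0// => Hb.
  have kc : 0 < k + n * c.
    rewrite -(pmulr_lgt0 _ e0); apply: (@lt_trans _ _ (3 * q * n)); last by lra.
    by rewrite mulr_gt0// mulr_gt0.
  by rewrite -(ltr_pM2l kc); lra.
Qed.

Section PowerGaps.
Context {R : realType}.
Variable q : R.
Hypothesis q0 : 0 < q.
Implicit Types x a b : R.

(** The gap at x between x^(1+q) and its tangent at 1. *)
Definition tan1_gap x := x * x `^ q - (1 + q) * x + q.

(** The gap at 1 between x^(1+q) and its tangent at x. *)
Definition at1_gap x := q * x * x `^ q - (1 + q) * x `^ q + 1.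

Lemma exp_coordinate x : 0 < x -> x != 1 ->
  exists2 s, s != 0 /\ 0 < s * (x - 1) &
    x = expk 1 s ^+ 3 /\ x `^ q = expk q s ^+ 3.
Proof.
move=> x0 x1; have lx : ln x != 0 by rewrite ln_eq0.
have xE : expR (ln x) = x by rewrite lnK ?posrE.
have s3 : 0 < (3:R)^-1 by rewrite invr_gt0.
exists (ln x / 3); split => //.
- by rewrite mulf_neq0// gt_eqF.
- rewrite mulrAC (pmulr_lgt0 _ s3) -[X in X - 1]xE.
  exact: expR_sub1_sign.
- by rewrite expkX /expk mulr1 mulrC divfK ?xE.
- by rewrite expkX /expk /powR gt_eqF//; congr expR; field.
Qed.

Lemma powR_sub1_sign x : 0 <= x -> x != 1 -> 0 < (x - 1) * (x `^ q - 1).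
Proof.
rewrite le_eqVlt => /predU1P[<- _|x0 x1].
  by rewrite powR0 ?gt_eqF// sub0r mulrNN mulr1.
have [s [s0 sx] [_ ->]] := exp_coordinate _ x0 x1.
apply: same_sign_trans sx _.
by rewrite expkX expk_sub1_sign// mulr_gt0.
Qed.

Lemma tan1_gap_gt0 x : 0 <= x -> x != 1 -> 0 < tan1_gap x.
Proof.
rewrite le_eqVlt /tan1_gap => /predU1P[<- _|x0 x1].
  by rewrite mul0r mulr0 subr0 add0r.
have [s [s0 _] [-> ->]] := exp_coordinate _ x0 x1.
exact: tan1_gap_e_gt0.
Qed.

Lemma at1_gap_gt0 x : 0 <= x -> x != 1 -> 0 < at1_gap x.
Proof.
rewrite le_eqVlt /at1_gap => /predU1P[<- _|x0 x1].
  by rewrite powR0 ?gt_eqF// !mulr0 subr0 add0r.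
have [s [s0 _] [-> ->]] := exp_coordinate _ x0 x1.
exact: at1_gap_e_gt0.
Qed.

Hypothesis q1 : q != 1.

Let p_neq0 : 1 + q != 0. Proof. by rewrite gt_eqF// addr_gt0. Qed.
Let q_neq0 : q != 0. Proof. by rewrite gt_eqF. Qed.
Let q1sqr : 0 < (1 - q) ^+ 2.
Proof. by rewrite lt_neqAle sqr_ge0 eq_sym sqrf_eq0 subr_eq0 eq_sym q1. Qed.

Lemma tan1_gap_quadratic x : 0 <= x -> x != 1 ->
  0 < (x - 1) * ((1 - q) * ((1 + q) * q / 2 * (x - 1) ^+ 2 - tan1_gap x)).
Proof.
rewrite le_eqVlt /tan1_gap => /predU1P[<- _|x0 x1].
  rewrite (_ : (0 - 1) * _ = q / 2 * (1 - q) ^+ 2); last by field.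
  by rewrite mulr_gt0// divr_gt0.
have [s [s0 sx] [xE AE]] := exp_coordinate _ x0 x1.
by apply: same_sign_trans sx _; rewrite AE xE; exact: tan1_gap_e_quadratic.
Qed.

Lemma at1_gap_quadratic x : 0 <= x -> x != 1 ->
  0 < (x - 1) * ((1 - q) * (at1_gap x - (1 + q) / (2 * q) * (x `^ q - 1) ^+ 2)).
Proof.
rewrite le_eqVlt /at1_gap => /predU1P[<- _|x0 x1].
  rewrite powR0 ?gt_eqF// (_ : (0 - 1) * _ = (1 - q) ^+ 2 / (2 * q)); last by field.
  by rewrite divr_gt0// mulr_gt0.
have [s [s0 sx] [xE AE]] := exp_coordinate _ x0 x1.
by apply: same_sign_trans sx _; rewrite AE xE; exact: at1_gap_e_quadratic.
Qed.

Definition lin x := 3 * q - curv_coef q / 2 * tan1_gap x.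
Definition offset x := at1_gap x / ((1 + q) * (x `^ q - 1)).

(** At x = 0 the coordinate s is not available, but there all quantities are
    rational functions of q. *)
Lemma tan1_gap_level x : 0 <= x -> x != 1 -> 0 < lin x ->
  0 < (x - 1) * ((1 - q) * (level_coef q * tan1_gap x - offset x ^+ 2 * lin x)).
Proof.
rewrite le_eqVlt /lin /offset /tan1_gap /at1_gap => /predU1P[<- _ _|x0 x1].
  rewrite powR0 ?gt_eqF// /curv_coef /level_coef.
  rewrite (_ : (0 - 1) * _ = (1 - q) ^+ 2 * (q / (6 * (1 + q) ^+ 3) * (8 + 7 * q))).
    by rewrite mulr_gt0// mulr_gt0 ?divr_gt0 ?mulr_gt0 ?exprn_gt0 ?addr_gt0// mulr_gt0.
  by field.
have [s [s0 sx] [xE AE]] := exp_coordinate _ x0 x1.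
move=> hx; apply: same_sign_trans sx _; move: hx; rewrite AE xE => hx; exact: level_sign.
Qed.

Section pair.
Variables a b : R.
Hypotheses (a0 : 0 <= a) (a1 : a < 1) (b1 : 1 < b).
Let b0 : 0 <= b. Proof. exact/ltW/(lt_trans _ b1). Qed.
Let an1 : a != 1. Proof. by rewrite lt_eqF. Qed.
Let bn1 : b != 1. Proof. by rewrite gt_eqF. Qed.
Let A1 : a `^ q < 1.
Proof. by have := powR_sub1_sign _ a0 an1; rewrite nmulr_rgt0 subr_lt0. Qed.
Let B1 : 1 < b `^ q.
Proof. by have := powR_sub1_sign _ b0 bn1; rewrite pmulr_rgt0 subr_gt0. Qed.

Let left x : 0 < (a - 1) * x -> x < 0.
Proof. by rewrite nmulr_rgt0// subr_lt0. Qed.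
Let right x : 0 < (b - 1) * x -> 0 < x.
Proof. by rewrite pmulr_rgt0// subr_gt0. Qed.

Lemma tan1_gap_midpoint : a + b = 2 -> 0 < (1 - q) * (tan1_gap a - tan1_gap b).
Proof.
move=> ab; have /right := tan1_gap_quadratic _ b0 bn1.
have /left := tan1_gap_quadratic _ a0 an1.
have -> : (a - 1) ^+ 2 = (b - 1) ^+ 2 by rewrite (_ : a = 2 - b); [ring|lra].
by lra.
Qed.

Lemma at1_gap_midpoint : a `^ q + b `^ q = 2 -> 0 < (1 - q) * (at1_gap b - at1_gap a).
Proof.
move=> ab; have /right := at1_gap_quadratic _ b0 bn1.
have /left := at1_gap_quadratic _ a0 an1.
have -> : (a `^ q - 1) ^+ 2 = (b `^ q - 1) ^+ 2.
  by rewrite (_ : a `^ q = 2 - b `^ q); [ring|lra].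
by lra.
Qed.

(** The two crossing points tau a 1 and tau 1 b are symmetric about 1. *)
Hypothesis critical : at1_gap a * (b `^ q - 1) = at1_gap b * (1 - a `^ q).

(** Comparing both gaps with their quadratic models, which depend only on the
    distances of a^q and b^q from 1, turns the symmetry of the crossing points
    into an order between these distances. *)
Lemma critical_powR : 0 < (1 - q) * ((1 - a `^ q) - (b `^ q - 1)).
Proof.
have /right := at1_gap_quadratic _ b0 bn1; have /left := at1_gap_quadratic _ a0 an1.
set c := (1 + q) / (2 * q); have c0 : 0 < c by rewrite divr_gt0 ?mulr_gt0 ?addr_gt0.
move: A1 B1 critical; set x := a `^ q; set y := b `^ q; set A := at1_gap a; set B := at1_gap b.
move=> x1 y1 e Ha Hb.
have {}Ha : 0 < (y - 1) * - ((1 - q) * (A - c * (x - 1) ^+ 2)).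
  by rewrite mulr_gt0 ?subr_gt0 ?oppr_gt0.
have {}Hb : 0 < (1 - x) * ((1 - q) * (B - c * (y - 1) ^+ 2)).
  by rewrite mulr_gt0 ?subr_gt0.
have : 0 < (1 - q) * (B * (1 - x) - A * (y - 1)) +
    c * ((1 - x) * (y - 1)) * ((1 - q) * ((1 - x) - (y - 1))).
  by have := addr_gt0 Ha Hb; congr (0 < _); ring.
rewrite e subrr mulr0 add0r pmulr_rgt0//.
by apply: mulr_gt0 c0 _; rewrite mulr_gt0 ?subr_gt0.
Qed.

Lemma critical_at1_gap : 0 < (1 - q) * (at1_gap a - at1_gap b).
Proof.
have B1' : 0 < b `^ q - 1 by rewrite subr_gt0.
rewrite -(pmulr_rgt0 _ B1').
have -> : (b `^ q - 1) * ((1 - q) * (at1_gap a - at1_gap b)) =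
    at1_gap b * ((1 - q) * ((1 - a `^ q) - (b `^ q - 1))).
  transitivity ((1 - q) * (at1_gap a * (b `^ q - 1) - at1_gap b * (b `^ q - 1))).
    by ring.
  by rewrite critical; ring.
by apply: mulr_gt0 critical_powR; exact: at1_gap_gt0.
Qed.

Lemma critical_tan1_gap : 0 < (1 - q) * (tan1_gap b - tan1_gap a).
Proof.
have Ea := tan1_gap_gt0 _ a0 an1; have Eb := tan1_gap_gt0 _ b0 bn1.
have offset_eq : offset a ^+ 2 = offset b ^+ 2.
  have B0 : b `^ q - 1 != 0 by rewrite subr_eq0 gt_eqF.
  have A0 : a `^ q - 1 != 0 by rewrite subr_eq0 lt_eqF.
  rewrite /offset (_ : at1_gap b = at1_gap a * (b `^ q - 1) / (1 - a `^ q)).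
    by field; rewrite p_neq0 A0 B0 -opprB oppr_eq0 A0.
  by rewrite critical mulfK// -opprB oppr_eq0.
have n0 : 0 < offset b ^+ 2.
  rewrite exprn_gt0// divr_gt0 ?at1_gap_gt0//.
  by apply: mulr_gt0; [rewrite addr_gt0|rewrite subr_gt0].
have k0 : 0 < level_coef q by rewrite divr_gt0// mulr_gt0// addr_gt0.
have p3 : 0 < 3 * (1 + q) by rewrite mulr_gt0// addr_gt0.
have c1 : curv_coef q / 2 < 1.
  rewrite /curv_coef ltr_pdivrMr// ltr_pdivrMr// -subr_gt0.
  rewrite (_ : _ - _ = 5 + 5 * q + 2 * q ^+ 2); last by ring.
  by rewrite addr_gt0 ?mulr_gt0 ?exprn_gt0 ?addr_gt0 ?mulr_gt0.
have cq : 0 < (1 - q) * (curv_coef q / 2).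
  rewrite (_ : _ * _ = (1 - q) ^+ 2 * ((1 + 2 * q) / (3 * (1 + q) * 2))); last first.
    by rewrite /curv_coef; field.
  by rewrite mulr_gt0// divr_gt0// ?mulr_gt0// ?addr_gt0// mulr_gt0.
have Eaq : q < 1 -> tan1_gap a <= q.
  move=> q_lt1; rewrite /tan1_gap -subr_ge0.
  rewrite (_ : _ - _ = a * (1 + q - a `^ q)); last by ring.
  by rewrite mulr_ge0// subr_ge0 (le_trans (ltW A1))// lerDl ltW.
apply: (level_order _ _ _ _ _ _ q0 q1 k0 n0 Ea Eb c1 cq Eaq).
- by move=> ha; rewrite -offset_eq; apply/left/tan1_gap_level.
- by move=> hb; apply/right/tan1_gap_level.
Qed.
End pair.
End PowerGaps.

(** * Volume of a truncated cone *)

(** The uniqueness of product measures, which exchanges the order of integration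
    in three variables, rests on this. *)
Lemma sigma_finite_plane (R : realType) :
  sigma_finite setT (@lebesgue_measure R \x @lebesgue_measure R)%E.
Proof.
pose F (n : nat) : set (R * R) := `[- n%:R, n%:R] `*` `[- n%:R, n%:R].
exists F.
  apply/esym; rewrite -subTset => -[x y] _.
  exists (Num.truncn (`|x| + `|y|)).+1 => //.
  have := truncnS_gt (`|x| + `|y|); set n := _.+1 => xyn.
  by split; rewrite /= in_itv/= -ler_norml (le_trans _ (ltW xyn))// ?lerDl ?lerDr.
move=> n; split; first exact: measurableX.
rewrite product_measure1E//= lebesgue_measure_itv/=.
by case: ifP => _; rewrite ?mule0 ?ltry// -EFinN -EFinD -EFinM ltry.
Qed.

Section Volume.
Context {R : realType}.
Implicit Types (L M : R * R) (a b c x y z t l u : R).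
Local Notation lam := (@lebesgue_measure R).

Lemma integral_is_derive (F f : R -> R) a b :
    (forall x, is_derive x 1 F (f x)) -> continuous f -> a < b ->
  (\int[lam]_(x in `[a, b]) (f x)%:E = (F b - F a)%:E)%E.
Proof.
move=> dF cf ab; have cF : continuous F.
  by move=> x; apply/differentiable_continuous/derivable1_diffP; case: (dF x).
rewrite (@continuous_FTC2 R _ F)//; first exact: continuous_subspaceT.
  split; first by move=> x _; case: (dF x).
  - exact/cvg_at_right_filter/cF.
  - exact/cvg_at_left_filter/cF.
by move=> x _; rewrite derive1E; case: (dF x).
Qed.

Lemma integral_affine a b (c0 c1 : R) : a <= b ->
  (\int[lam]_(x in `[a, b]) (c0 + c1 * x)%:E =
   ((b - a) * (c0 + c1 * ((a + b) / 2)))%:E)%E.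
Proof.
rewrite le_eqVlt => /predU1P[->|ab].
  by rewrite set_itv1 integral_set1 subrr mul0r.
have dF x : is_derive x 1 (fun x => x * (c0 - - (c1 / 2) * x)) (c0 + c1 * x).
  rewrite (_ : (fun _ => _) = id * (cst c0 - (- (c1 / 2)) *: id))//.
  by apply: is_derive_eq; rewrite ?fctE /GRing.scale/=; field.
rewrite (integral_is_derive _ _ _ _ dF)//; first by congr EFin; field.
move=> x; apply: continuousD; first exact: cst_continuous.
by apply: continuousM; [exact: cst_continuous|exact: cvg_id].
Qed.

Lemma integral_itv_split a b c (f : R -> \bar R) : a <= b -> b <= c ->
    measurable_fun [set: R] f -> (forall x, 0 <= f x)%E ->
  (\int[lam]_(x in `[a, c]) f x =
   \int[lam]_(x in `[a, b]) f x + \int[lam]_(x in `[b, c]) f x)%E.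
Proof.
move=> ab bc mf f0.
have -> : `[a, c]%classic = `[a, b] `|` `]b, c].
  by rewrite -itv_bndbnd_setU// bnd_simp.
rewrite ge0_integral_setU//; last 2 first.
- by apply: measurable_funTS.
- apply/disj_setPS => x [/=]; rewrite !in_itv/= => /andP[_ xb] /andP[bx _].
  by move: (lt_le_trans bx xb); rewrite ltxx.
congr (_ + _)%E.
by rewrite integral_itv_obnd_cbnd//; apply: measurable_funTS.
Qed.

Lemma lebesgue_measure_segment a b : a <= b -> lam `[a, b]%classic = (b - a)%:E.
Proof.
move=> ab; rewrite lebesgue_measure_itv/= lte_fin; case: ltP => [_|ba].
  by rewrite EFinB.
by rewrite (le_anti (introT andP (conj ab ba))) subrr.
Qed.

(** The perspective (x, z) |-> z L(x / z) of the affine function L with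
    intercept L.1 and slope L.2; its value at (x, 1) is L(x). *)
Definition hom L x z := L.1 * z + L.2 * x.

Lemma homZ L z t : hom L (t * z) z = z * hom L t 1.
Proof. by rewrite /hom; ring. Qed.

Lemma hom_le L L' x z l u : 0 <= z -> l * z <= x <= u * z ->
  (forall t, l <= t <= u -> hom L t 1 <= hom L' t 1) -> hom L x z <= hom L' x z.
Proof.
rewrite le_eqVlt => /predU1P[<-|z0].
  by rewrite !mulr0 -eq_le => /eqP <- _; rewrite /hom !mulr0 addr0.
rewrite -(ler_pdivlMr _ _ z0) -(ler_pdivrMr _ _ z0) => xlu LL'.
rewrite -[x](divfK (lt0r_neq0 z0)) !homZ ler_pM2l//.
exact: LL'.
Qed.

(** The polygon l <= x <= u, max (L1, L2, L3) <= y <= M dilated by z.  In this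
    homogeneous form z = 0 gives the apex of the cone without any division. *)
Definition slice l u (L1 L2 L3 M : R * R) z : set (R * R) :=
  [set v | [/\ l * z <= v.1 <= u * z, v.2 <= hom M v.1 z &
    [/\ hom L1 v.1 z <= v.2, hom L2 v.1 z <= v.2 & hom L3 v.1 z <= v.2] ] ].

Definition frustum l u L1 L2 L3 M : set (R * R * R) :=
  [set w | 0 <= w.2 <= 1 /\ slice l u L1 L2 L3 M w.2 w.1].

Lemma frustumE l u L1 L2 L3 M : frustum l u L1 L2 L3 M =
  [set w : R * R * R | 0 <= w.2] `&` [set w | w.2 <= 1] `&`
  [set w | l * w.2 <= w.1.1] `&` [set w | w.1.1 <= u * w.2] `&`
  [set w | w.1.2 <= hom M w.1.1 w.2] `&` [set w | hom L1 w.1.1 w.2 <= w.1.2] `&`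
  [set w | hom L2 w.1.1 w.2 <= w.1.2] `&` [set w | hom L3 w.1.1 w.2 <= w.1.2].
Proof.
apply/seteqP; split => w.
  by case=> /andP[? ?] [/andP[? ?] ? [? ? ?]]; do !split.
by case=> [[[[[[[]]]]]]] => ? ? ? ? ? ? ? ?;
  split; [apply/andP|split => //; apply/andP].
Qed.

Lemma measurable_le_set d (T : measurableType d) (f g : T -> R) :
  measurable_fun setT f -> measurable_fun setT g ->
  measurable [set w : T | f w <= g w].
Proof.
move=> mf mg.
have := measurable_fun_ler mf mg measurableT (I : measurable [set true]).
by rewrite setTI.
Qed.

Lemma measurable_frustum l u L1 L2 L3 M : measurable (frustum l u L1 L2 L3 M).
Proof.
have m1 : measurable_fun setT (fun w : R * R * R => w.1.1).
  by apply: measurableT_comp; [exact: measurable_fst|exact: measurable_fst].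
have m2 : measurable_fun setT (fun w : R * R * R => w.1.2).
  by apply: measurableT_comp; [exact: measurable_snd|exact: measurable_fst].
have m3 : measurable_fun setT (fun w : R * R * R => w.2) by exact: measurable_snd.
have mc (a : R) : measurable_fun setT (fun w : R * R * R => a * w.2).
  by apply: measurable_funM => //; exact: measurable_cst.
have mh L : measurable_fun setT (fun w : R * R * R => hom L w.1.1 w.2).
  by apply: measurable_funD; apply: measurable_funM => //; exact: measurable_cst.
rewrite frustumE.
by do ![apply: measurableI]; apply: measurable_le_set => //; exact: measurable_cst.
Qed.

Section frustum_volume.
Variables (l t1 t2 u : R) (L1 L2 L3 M : R * R).
Hypotheses (lt1 : l <= t1) (t12 : t1 <= t2) (t2u : t2 <= u).
Hypothesis first_piece : forall t, l <= t <= t1 ->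
  [/\ hom L2 t 1 <= hom L1 t 1, hom L3 t 1 <= hom L1 t 1 & hom L1 t 1 <= hom M t 1].
Hypothesis second_piece : forall t, t1 <= t <= t2 ->
  [/\ hom L1 t 1 <= hom L2 t 1, hom L3 t 1 <= hom L2 t 1 & hom L2 t 1 <= hom M t 1].
Hypothesis third_piece : forall t, t2 <= t <= u ->
  [/\ hom L1 t 1 <= hom L3 t 1, hom L2 t 1 <= hom L3 t 1 & hom L3 t 1 <= hom M t 1].

Local Notation slice := (slice l u L1 L2 L3 M).
Local Notation F := (frustum l u L1 L2 L3 M).
Local Notation T := (measurableTypeR R).

Let measurableF : @measurable _ (T * T * T)%type F.
Proof. exact: measurable_frustum. Qed.

Lemma ysection_frustum z : 0 <= z <= 1 -> ysection F z = slice z.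
Proof.
move=> z01; apply/seteqP.
by split=> v; [move=> /set_mem[]|move=> vS; apply/mem_set].
Qed.

(** The area between the lines M and L over [a, b]: a trapezoid has the area of
    the rectangle of the same width and middle height. *)
Definition strip_area a b L := (b - a) * ((M.1 - L.1) + (M.2 - L.2) * ((a + b) / 2)).

Lemma integral_strip z a b L : 0 <= z -> l <= a -> a <= b -> b <= u ->
    (forall t, a <= t <= b -> [/\ hom L1 t 1 <= hom L t 1, hom L2 t 1 <= hom L t 1,
        hom L3 t 1 <= hom L t 1 & hom L t 1 <= hom M t 1]) ->
    (L = L1 \/ L = L2 \/ L = L3) ->
  (\int[lam]_(x in `[(a * z)%R, (b * z)%R]) lam (xsection (slice z) x) =
     (z ^+ 2 * strip_area a b L)%:E)%E.
Proof.
move=> z0 la ab bu Lmax LE.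
transitivity (\int[lam]_(x in `[(a * z)%R, (b * z)%R])
    ((M.1 - L.1) * z + (M.2 - L.2) * x)%:E)%E; last first.
  by rewrite integral_affine ?ler_wpM2r// /strip_area; congr EFin; field.
apply: eq_integral => x; rewrite inE/= in_itv/= => xab.
have Lx L' : (forall t, a <= t <= b -> hom L' t 1 <= hom L t 1) ->
    hom L' x z <= hom L x z.
  exact: hom_le.
have LM : hom L x z <= hom M x z.
  by apply: (hom_le _ _ _ _ a b) => // t /Lmax[].
rewrite (_ : xsection _ _ = `[hom L x z, hom M x z]%classic).
  by rewrite lebesgue_measure_segment//; congr EFin; rewrite /hom; ring.
rewrite set_itvcc; apply/seteqP; split => y.
  by move=> /set_mem/= [_ -> [? ? ?]]; rewrite andbT; case: LE => [->|[->|->]].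
move=> /= /andP[Ly yM]; apply/mem_set.
have [xa xb] := andP xab.
split => //.
  by rewrite (le_trans _ xa) ?(le_trans xb)// ler_wpM2r.
by split; apply: le_trans Ly; apply: Lx => t /Lmax[].
Qed.

Definition cross_area := strip_area l t1 L1 + strip_area t1 t2 L2 + strip_area t2 u L3.

Lemma slice_area z : 0 <= z <= 1 ->
  (lam \x lam)%E (slice z) = (z ^+ 2 * cross_area)%:E.
Proof.
move=> z01; have /andP[z0 _] := z01; rewrite /product_measure1.
have mf : measurable_fun [set: R] (fun x => lam (xsection (slice z) x)).
  apply: measurable_fun_xsection; rewrite -ysection_frustum//.
  exact: measurable_ysection.
have f0 x : (0 <= lam (xsection (slice z) x))%E by exact: measure_ge0.
transitivity (\int[lam]_(x in `[(l * z)%R, (u * z)%R]) lam (xsection (slice z) x))%E.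
  rewrite [RHS]integral_mkcond; apply: eq_integral => x _ /=.
  rewrite patchE; case: ifPn => //; rewrite notin_setE/= in_itv/= => xlu.
  rewrite (_ : xsection _ _ = set0) ?measure0//.
  by apply/seteqP; split => y // /set_mem[].
rewrite (@integral_itv_split _ (t1 * z))//; last 2 first.
  by rewrite ler_wpM2r.
  by rewrite ler_wpM2r// (le_trans t12).
rewrite (@integral_itv_split (t1 * z) (t2 * z))//; last 2 first.
  by rewrite ler_wpM2r.
  by rewrite ler_wpM2r.
rewrite (@integral_strip z l t1 L1)//; last 3 first.
- by rewrite (le_trans t12).
- by move=> t /first_piece[].
- by left.
rewrite (@integral_strip z t1 t2 L2)//; last 2 first.
- by move=> t /second_piece[].
- by right; left.
rewrite (@integral_strip z t2 u L3)//; last 3 first.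
- by rewrite (le_trans lt1).
- by move=> t /third_piece[].
- by right; right.
by rewrite -!EFinD; congr EFin; rewrite /cross_area; ring.
Qed.

(** The measure integrates over the plane first; exchanging the order of
    integration gives the slices at constant z, whose areas are proportional to
    z^2, whence the factor 1/3. *)
Lemma vol3_frustum : vol3 F = (cross_area / 3)%:E.
Proof.
pose m1 : {sigma_finite_measure set T -> \bar R} := lam.
pose m12 : {sigma_finite_measure set (T * T)%type -> \bar R} :=
  HB.pack (m1 \x m1)%E (Measure_isSigmaFinite.Build _ _ _ (m1 \x m1)%E
    (sigma_finite_plane R)).
pose prod' : {measure set (T * T * T)%type -> \bar R} := (m12 \x^ m1)%E.
transitivity (prod' F).
  have prod'E (A : set (T * T)%type) (B : set T) : measurable A -> measurable B ->
      prod' (A `*` B) = (m12 A * m1 B)%E.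
    by move=> mA mB; exact: product_measure2E.
  exact: (product_measure_unique prod'E measurableF).
rewrite /prod'/= /product_measure2.
transitivity (\int[lam]_(z in `[0%R, 1%R]) (z ^+ 2 * cross_area)%:E)%E.
  rewrite [RHS]integral_mkcond; apply: eq_integral => z _ /=.
  rewrite patchE; case: ifPn.
    rewrite inE/= in_itv/= => z01.
    by rewrite ysection_frustum// -slice_area.
  rewrite notin_setE/= in_itv/= => z01.
  rewrite (_ : ysection _ _ = set0) ?measure0//.
  by apply/seteqP; split => v // /set_mem[].
have dF z : is_derive z 1 (fun z => z ^+ 3 / 3 * cross_area) (z ^+ 2 * cross_area).
  rewrite (_ : (fun _ => _) = (id ^+ 3) * cst (3^-1) * cst cross_area)//.
  by apply: is_derive_eq; rewrite ?fctE /GRing.scale/=; field.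
rewrite (integral_is_derive _ _ _ _ dF)//; first by congr EFin; field.
move=> z; apply: (@continuousM _ _ (fun z : R => z ^+ 2) (cst cross_area)).
  exact: exprn_continuous.
exact: cst_continuous.
Qed.

End frustum_volume.
End Volume.

(** * Tangents and the piecewise linear under-estimator *)

Section Tangents.
Context {R : realType}.
Variable p : R.
Hypothesis p1 : 1 < p.
Implicit Types a b c t x : R.
Let q := p - 1.
Let q0 : 0 < q. Proof. by rewrite subr_gt0. Qed.
Let p0 : 0 < p. Proof. exact: lt_trans p1. Qed.

Lemma powR_split x : 0 <= x -> x `^ p = x * x `^ q.
Proof. by move=> x0; rewrite mulr_powRB1. Qed.

Lemma powR_divq x c : 0 <= x -> 0 < c -> (x / c) `^ q = x `^ q / c `^ q.
Proof.
move=> x0 c0; have c0' := ltW c0.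
by rewrite powRM ?invr_ge0// -(powR_inv1 c0') powRAC (powR_inv1 (powR_ge0 _ _)).
Qed.

(** Homogeneity reduces gaps at a general point c to gaps at 1. *)
Lemma tan1_gap_scale x c : 0 <= x -> 0 < c ->
  tan1_gap q (x / c) * c `^ p = x `^ p - p * x * c `^ q + q * c `^ p.
Proof.
move=> x0 c0; rewrite /tan1_gap powR_divq// !powR_split// ?(ltW c0)//.
have pE : p = 1 + q by rewrite /q subrKC.
rewrite [in RHS]pE; field.
by rewrite !gt_eqF// powR_gt0.
Qed.

Lemma at1_gap_scale x c : 0 <= x -> 0 < c ->
  at1_gap q (x / c) * c `^ p = q * x `^ p - p * x `^ q * c + c `^ p.
Proof.
move=> x0 c0; rewrite /at1_gap powR_divq// !powR_split// ?(ltW c0)//.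
have pE : p = 1 + q by rewrite /q subrKC.
rewrite [in RHS]pE; field.
by rewrite !gt_eqF// powR_gt0.
Qed.

Definition tangent c : R * R := (c `^ p - dpow p c * c, dpow p c).

Lemma tangent_gap x c : 0 <= x -> 0 < c ->
  x `^ p - hom (tangent c) x 1 = c `^ p * tan1_gap q (x / c).
Proof.
move=> x0 c0; rewrite mulrC tan1_gap_scale// /tangent /hom /dpow/= -/q.
by rewrite [c `^ p]powR_split ?(ltW c0)// /q; ring.
Qed.

Lemma tangent_lt x c : 0 <= x -> 0 < c -> x != c -> hom (tangent c) x 1 < x `^ p.
Proof.
move=> x0 c0 xc; rewrite -subr_gt0 tangent_gap// mulr_gt0 ?powR_gt0//.
rewrite tan1_gap_gt0// ?divr_ge0 ?(ltW c0)//.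
by apply: contra xc => /eqP/divr1_eq ->.
Qed.

Lemma tangent_self c : hom (tangent c) c 1 = c `^ p.
Proof. by rewrite /hom/=; ring. Qed.

Lemma tangent_le x c : 0 <= x -> 0 <= c -> hom (tangent c) x 1 <= x `^ p.
Proof.
move=> x0; rewrite le_eqVlt => /predU1P[<-|c0].
  rewrite /hom/= /dpow !powR0 ?gt_eqF// !mulr0 !mul0r subrr addr0.
  by rewrite mul0r powR_ge0.
have [->|xc] := eqVneq x c; first by rewrite tangent_self.
exact/ltW/tangent_lt.
Qed.

Lemma dpow_lt a b : 0 <= a -> a < b -> dpow p a < dpow p b.
Proof.
move=> a0 ab; rewrite /dpow ltr_pM2l// gt0_ltr_powR// nnegrE// ltW//.
exact: le_lt_trans ab.
Qed.

Lemma tangent_cross a b t : 0 <= a -> a < b ->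
  hom (tangent b) t 1 - hom (tangent a) t 1 = (dpow p b - dpow p a) * (t - tau p a b).
Proof.
move=> a0 ab; have := dpow_lt _ _ a0 ab; rewrite -subr_gt0 => dab.
rewrite /hom /tau/=; field.
by rewrite -opprB oppr_eq0 gt_eqF.
Qed.

(** At a the tangent at b is strictly below the graph, hence below the tangent
    at a; so a is on the left of the crossing point. *)
Lemma tau_gt a b : 0 <= a -> a < b -> a < tau p a b.
Proof.
move=> a0 ab; have b0 : 0 < b by exact: le_lt_trans ab.
have dab := dpow_lt _ _ a0 ab.
have := tangent_lt _ _ a0 b0; rewrite lt_eqF// => /(_ isT).
rewrite -(tangent_self a) -subr_lt0 tangent_cross//.
by rewrite pmulr_rlt0 ?subr_gt0// subr_lt0.
Qed.

Lemma tau_lt a b : 0 <= a -> a < b -> tau p a b < b.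
Proof.
move=> a0 ab; have b0 : 0 < b by exact: le_lt_trans ab.
have dab := dpow_lt _ _ a0 ab.
have Tab : hom (tangent a) b 1 < b `^ p.
  have [az|az] := eqVneq a 0.
    rewrite az /hom/= /dpow !powR0 ?gt_eqF// !mulr0 !mul0r subrr addr0.
    by rewrite ?mul0r powR_gt0.
  by apply: tangent_lt; rewrite ?(ltW b0) ?gt_eqF// lt_neqAle eq_sym az.
move: Tab; rewrite -(tangent_self b) -subr_gt0 tangent_cross//.
by rewrite pmulr_rgt0 ?subr_gt0.
Qed.

Definition chord l u : R * R :=
  (l `^ p - secant_slope p l u * l, secant_slope p l u).

(** Both sides are affine, so the endpoints suffice, where the chord touches the
    graph. *)
Lemma tangent_le_chord l u c t : 0 <= l -> l < u -> 0 <= c -> l <= t <= u ->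
  hom (tangent c) t 1 <= hom (chord l u) t 1.
Proof.
move=> l0 lu c0 /andP[lt tu]; have u0 : 0 <= u by rewrite (le_trans l0)// ltW.
have Hl := tangent_le _ _ l0 c0; have Hu := tangent_le _ _ u0 c0.
have ul : 0 < u - l by rewrite subr_gt0.
have chordl : hom (chord l u) l 1 = l `^ p by rewrite /hom/=; ring.
have chordu : hom (chord l u) u 1 = u `^ p.
  by rewrite /hom/= /secant_slope; field; rewrite gt_eqF.
rewrite -chordl in Hl; rewrite -chordu in Hu.
rewrite -(ler_pM2r ul).
have hE L : hom L t 1 * (u - l) = hom L l 1 * (u - t) + hom L u 1 * (t - l).
  by rewrite /hom; ring.
by rewrite !hE lerD// ler_wpM2r// subr_ge0.
Qed.

Section relaxation.
Variables l u xi : R.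
Hypotheses (l0 : 0 <= l) (lxi : l < xi) (xiu : xi < u).
Let xi0 : 0 < xi. Proof. exact: le_lt_trans lxi. Qed.
Let lu : l < u. Proof. exact: lt_trans xiu. Qed.
Let u0 : 0 < u. Proof. exact: lt_trans xiu. Qed.
Local Notation t1 := (tau p l xi).
Local Notation t2 := (tau p xi u).

Lemma first_piece t : l <= t <= t1 ->
  [/\ hom (tangent xi) t 1 <= hom (tangent l) t 1,
      hom (tangent u) t 1 <= hom (tangent l) t 1 &
      hom (tangent l) t 1 <= hom (chord l u) t 1].
Proof.
move=> /andP[lt tt1].
have h1 : hom (tangent xi) t 1 <= hom (tangent l) t 1.
  rewrite -subr_le0 tangent_cross// pmulr_rle0 ?subr_le0//.
  by rewrite subr_gt0 dpow_lt.
have tau12 : t1 < t2.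
  by rewrite (lt_trans (tau_lt _ _ l0 lxi))// tau_gt// ltW.
split => //.
  apply: le_trans h1.
  rewrite -subr_le0 tangent_cross ?(ltW xi0)// pmulr_rle0 ?subr_le0.
    by rewrite (le_trans tt1)// ltW.
  by rewrite subr_gt0 dpow_lt// ltW.
apply: tangent_le_chord => //; rewrite lt (le_trans tt1)// ltW//.
by rewrite (lt_trans tau12)// tau_lt// ltW.
Qed.

Lemma second_piece t : t1 <= t <= t2 ->
  [/\ hom (tangent l) t 1 <= hom (tangent xi) t 1,
      hom (tangent u) t 1 <= hom (tangent xi) t 1 &
      hom (tangent xi) t 1 <= hom (chord l u) t 1].
Proof.
move=> /andP[t1t tt2]; split.
- rewrite -subr_ge0 tangent_cross// mulr_ge0 ?subr_ge0//.
  by rewrite ltW// dpow_lt.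
- rewrite -subr_le0 tangent_cross ?(ltW xi0)// pmulr_rle0 ?subr_le0//.
  by rewrite subr_gt0 dpow_lt// ltW.
- apply: tangent_le_chord; rewrite ?(ltW xi0)//; apply/andP; split.
    by rewrite (le_trans _ t1t)// ltW// tau_gt.
  by rewrite (le_trans tt2)// ltW// tau_lt// ltW.
Qed.

Lemma third_piece t : t2 <= t <= u ->
  [/\ hom (tangent l) t 1 <= hom (tangent u) t 1,
      hom (tangent xi) t 1 <= hom (tangent u) t 1 &
      hom (tangent u) t 1 <= hom (chord l u) t 1].
Proof.
move=> /andP[t2t tu].
have tau12 : t1 < t2.
  by rewrite (lt_trans (tau_lt _ _ l0 lxi))// tau_gt// ltW.
have h1 : hom (tangent xi) t 1 <= hom (tangent u) t 1.
  rewrite -subr_ge0 tangent_cross ?(ltW xi0)// mulr_ge0 ?subr_ge0//.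
  by rewrite ltW// dpow_lt// ltW.
split => //.
  apply: le_trans h1.
  rewrite -subr_ge0 tangent_cross// mulr_ge0 ?subr_ge0//.
    by rewrite ltW// dpow_lt.
  by rewrite (le_trans _ t2t)// ltW.
apply: tangent_le_chord; rewrite ?(ltW u0)// tu andbT (le_trans _ t2t)// ltW//.
by rewrite (lt_trans _ tau12)// tau_gt.
Qed.

(** Each segment of the polyline joins two points of one tangent: the vertices
    are crossing points, and so lie on both adjacent tangents. *)
Lemma under_estimatorE t : l <= t <= u ->
  under_estimator p l xi u t = hom (if t <= t1 then tangent l
     else if t <= t2 then tangent xi else tangent u) t 1.
Proof.
move=> /andP[lt tu].
have l1 := tau_gt _ _ l0 lxi; have x2 := tau_gt _ _ (ltW xi0) xiu.
have x1 := tau_lt _ _ l0 lxi; have u2 := tau_lt _ _ (ltW xi0) xiu.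
have c1 : hom (tangent xi) t1 1 = hom (tangent l) t1 1.
  by apply/eqP; rewrite -subr_eq0 tangent_cross// subrr mulr0.
have c2 : hom (tangent u) t2 1 = hom (tangent xi) t2 1.
  by apply/eqP; rewrite -subr_eq0 tangent_cross ?(ltW xi0)// subrr mulr0.
rewrite /under_estimator /= tu.
have v1 : l `^ p = hom (tangent l) l 1 by rewrite tangent_self.
have vx : xi `^ p + dpow p xi * (t1 - xi) = hom (tangent l) t1 1.
  by rewrite -c1 /hom/=; ring.
have v2 : u `^ p + dpow p u * (t2 - u) = hom (tangent xi) t2 1.
  by rewrite -c2 /hom/=; ring.
have vu : u `^ p = hom (tangent u) u 1 by rewrite tangent_self.
have seg L a b : a < b ->
    segment_line (a, hom L a 1) (b, hom L b 1) t = hom L t 1.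
  move=> ab; rewrite /segment_line/= /hom; field.
  by rewrite subr_eq0 gt_eqF.
rewrite /tangent_vertex.
case: ifP => _; first by rewrite v1 vx seg.
case: ifP => _; first by rewrite vx -c1 v2 seg// (lt_trans x1).
by rewrite v2 -c2 vu seg.
Qed.

(** In other words, the under-estimator is the maximum of the three
    tangents. *)
Lemma under_estimator_le t y : l <= t <= u ->
  under_estimator p l xi u t <= y <->
  [/\ hom (tangent l) t 1 <= y, hom (tangent xi) t 1 <= y & hom (tangent u) t 1 <= y].
Proof.
move=> ltu; rewrite under_estimatorE//; have /andP[lt tu] := ltu.
case: ifPn => [tt1|]; last rewrite -ltNge => /ltW t1t.
  have [|h1 h2 _] := first_piece t; first by rewrite lt.
  by split=> [h|[]//]; split => //; exact: le_trans h.
case: ifPn => [tt2|]; last rewrite -ltNge => /ltW t2t.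
  have [|h1 h2 _] := second_piece t; first by rewrite t1t.
  by split=> [h|[]//]; split => //; exact: le_trans h.
have [|h1 h2 _] := third_piece t; first by rewrite t2t.
by split=> [h|[]//]; split => //; exact: le_trans h.
Qed.

End relaxation.
End Tangents.

(** * The relaxation is a truncated cone *)

Section FrustumHull.
Context {R : realType}.
Variables (l u : R) (L1 L2 L3 M : R * R).
Local Notation V := (R^o * R^o * R^o)%type.
Local Notation F := (frustum l u L1 L2 L3 M : set V).

Lemma closed_le_fun (f g : V -> R) : continuous f -> continuous g ->
  closed [set w | f w <= g w].
Proof.
move=> cf cg; rewrite (_ : mkset _ = (fun w => f w - g w) @^-1` [set x | x <= 0]).
  apply: (proj1 (continuous_closedP _)); last exact: closed_le.
  by move=> w; apply: continuousB; [exact: cf|exact: cg].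
by apply/seteqP; split => w; rewrite /= subr_le0.
Qed.

Lemma closed_frustum : closed F.
Proof.
have c1 : continuous (fun w : V => w.1.1 : R).
  by move=> w; apply: continuous_comp; exact: cvg_fst.
have c2 : continuous (fun w : V => w.1.2 : R).
  by move=> w; apply: continuous_comp; [exact: cvg_fst|exact: cvg_snd].
have c3 : continuous (fun w : V => w.2 : R) by move=> w; exact: cvg_snd.
have cc (a : R) : continuous (fun w : V => a * w.2).
  by move=> w; apply: continuousM; [exact: cst_continuous|exact: c3].
have ch L : continuous (fun w : V => hom L w.1.1 w.2).
  have cc1 : continuous (fun w : V => L.2 * (w.1.1 : R) : R).
    by move=> w; exact: (cvgM (cvg_cst (L.2 : R)) (c1 w)).
  by move=> w; exact: (cvgD (cc L.1 w) (cc1 w)).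
have ck (a : R) : continuous (fun w : V => a) by exact: cst_continuous.
rewrite frustumE.
by do ![apply: (@closedI V)]; apply: closed_le_fun.
Qed.

Lemma convex_frustum : @convex_set R V F.
Proof.
move=> v w k; rewrite !inE => -[/andP[v0 v1] [/andP[lv vu] vM [h1 h2 h3]]]
  [/andP[w0 w1] [/andP[lw wu] wM [g1 g2 g3]]].
have k0 : 0 <= k%:num by [].
have k1 : 0 <= (1 - k%:num) by rewrite subr_ge0.
have comb (a b a' b' : R) : a <= b -> a' <= b' ->
   k%:num * a + (1 - k%:num) * a' <= k%:num * b + (1 - k%:num) * b'.
  by move=> ab ab'; rewrite lerD// ler_wpM2l.
have homE L : hom L (k%:num * v.1.1 + (1 - k%:num) * w.1.1) (k%:num * v.2 + (1 - k%:num) * w.2)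
  = k%:num * hom L v.1.1 v.2 + (1 - k%:num) * hom L w.1.1 w.2.
  by rewrite /hom; ring.
have mE (a : R) : a * (k%:num * v.2 + (1 - k%:num) * w.2) =
  k%:num * (a * v.2) + (1 - k%:num) * (a * w.2) by ring.
split => /=.
  rewrite /= addr_ge0 ?mulr_ge0//=.
  have -> : 1 = k%:num * 1 + (1 - k%:num) * 1 :> R by ring.
  exact: comb.
split => /=.
- by rewrite !mE; apply/andP; split; exact: comb.
- by rewrite homE; exact: comb.
- by rewrite !homE; split; exact: comb.
Qed.

End FrustumHull.

Section Relaxation.
Context {R : realType}.
Variables p l u xi : R.
Hypotheses (p1 : 1 < p) (l0 : 0 <= l) (lxi : l < xi) (xiu : xi < u).
Let lu : l < u. Proof. exact: lt_trans xiu. Qed.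
Local Notation V := (R^o * R^o * R^o)%type.
Local Notation F := (frustum l u (tangent p l) (tangent p xi) (tangent p u) (chord p l u) : set V).

(** Conversely, a point of the frustum has y >= 0 because the tangent at l is
    nonnegative on [l, u]. *)
Lemma U_points_frustum (w : V) : 0 < w.2 -> U_points p l xi u w <-> F w.
Proof.
case: w => -[x y] z /= z0.
have z0' := ltW z0; have zn := lt0r_neq0 z0.
have xzE : (l * z <= x <= u * z) = (l <= x / z <= u).
  by rewrite ler_pdivlMr// ler_pdivrMr.
have hz L : hom L x z = z * hom L (x / z) 1 by rewrite -homZ divfK.
have under : l <= x / z <= u ->
    z * under_estimator p l xi u (x / z) <= y <->
    [/\ hom (tangent p l) x z <= y, hom (tangent p xi) x z <= y & hom (tangent p u) x z <= y].
  move=> xz; rewrite !hz -!(ler_pdivlMl _ _ z0).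
  exact: under_estimator_le.
split.
  case=> /= /andP[gy yc] xz /andP[_ z1] y0; split=> /=; first by rewrite z0'.
  by split => //; apply/under; rewrite -?xzE.
case=> /= /andP[_ z1] [/= xz yc Ly]; split => /=; rewrite ?z0//.
  by apply/andP; split => //; apply/under; rewrite -?xzE.
case: Ly => Ly _ _; apply: le_trans Ly.
rewrite hz mulr_ge0// /hom/= mulr1 -addrA [- _ + _]addrC -mulrBr addr_ge0 ?powR_ge0//.
rewrite mulr_ge0 ?subr_ge0//; last by move: xz; rewrite xzE => /andP[].
by rewrite /dpow mulr_ge0 ?powR_ge0// ltW// (lt_trans _ p1).
Qed.

(** The frustum is closed and convex, and it consists of the defining points and
    of the apex, which is the limit of the points of the edge over l. *)
Lemma breveU_frustum : breveU p l xi u = F.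
Proof.
apply/seteqP; split.
  rewrite /breveU closureE; apply: smallest_sub; first exact: closed_frustum.
  move=> w; apply; split; first exact: convex_frustum.
  move=> v Uv; apply/U_points_frustum => //.
  by case: Uv => _ _ /andP[].
have sub (w : V) : U_points p l xi u w -> breveU p l xi u w.
  by move=> Uw; apply: subset_closure => C [_]; exact.
move=> w Fw; have [/andP[z0 _] _] := Fw.
move: z0; rewrite le_eqVlt => /predU1P[z0|z0]; last exact/sub/U_points_frustum.
have {Fw w z0} -> : w = (0, 0, 0).
  move: Fw; case: w z0 => -[x y] z /= <- [_ [/=]].
  rewrite !mulr0 -eq_le => /eqP <-; rewrite /hom/= !mulr0 addr0 => y0 [y0' _ _].
  by congr (_, _, _); apply/le_anti/andP.
pose v (z : R) : V := (l * z, l `^ p * z, z).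
apply: (@closed_cvg _ _ (0:R)^'+ _ v (breveU p l xi u) _ _ (0, 0, 0)).
- exact: closed_closure.
- near=> z; apply/sub/U_points_frustum => //=.
  have z0 : 0 < z by [].
  split=> /=; first by rewrite (ltW z0)/=; near: z; exact: nbhs_right_le.
  have hE L : hom L (l * z) z = z * hom L l 1 by rewrite homZ.
  split=> /=.
  + by rewrite lexx/= ler_pM2r// ltW.
  + rewrite hE mulrC ler_pM2l// -(tangent_self p l).
    by apply: tangent_le_chord => //; rewrite lexx ltW.
  + have xi0 : 0 <= xi by rewrite (le_trans l0)// ltW.
    have u0 : 0 <= u by rewrite (le_trans l0)// ltW.
    by rewrite !hE [l `^ p * z]mulrC !ler_pM2l//; split; exact: tangent_le.
- have cM (a : R) : a * z @[z --> 0^'+] --> (0:R).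
    rewrite -[X in _ --> X](mulr0 a); apply: cvgM; first exact: cvg_cst.
    exact/cvg_at_right_filter/cvg_id.
  have c1 : z @[z --> 0^'+] --> (0:R) by exact/cvg_at_right_filter/cvg_id.
  exact: (cvg_pair (cvg_pair (cM l) (cM (l `^ p))) c1).
Unshelve. all: end_near. Qed.

End Relaxation.

(** * The equation satisfied by a minimizer *)

Section Critical.
Context {R : realType}.
Implicit Types (L M : R * R).

(** Moving a breakpoint from the crossing point t of two lines to s changes the
    area by that of the triangle between the lines and the vertical at s. *)
Lemma cross_area_breakpoints (l u s1 s2 t1 t2 d1 d2 : R) L1 L2 L3 M :
    (forall x, hom L2 x 1 - hom L1 x 1 = d1 * (x - t1)) ->
    (forall x, hom L3 x 1 - hom L2 x 1 = d2 * (x - t2)) ->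
  cross_area l s1 s2 u L1 L2 L3 M =
  cross_area l t1 t2 u L1 L2 L3 M + d1 / 2 * (s1 - t1) ^+ 2 + d2 / 2 * (s2 - t2) ^+ 2.
Proof.
case: L1 L2 L3 M => [k1 b1] [k2 b2] [k3 b3] [m n]; rewrite /hom/= => c1 c2.
have [c10 c11 c20 c21] := And4 (c1 0) (c1 1) (c2 0) (c2 1).
have {c1} k2E : k2 = k1 - d1 * t1 by lra.
have {c10 c11} b2E : b2 = b1 + d1 by lra.
have {c2} k3E : k3 = k2 - d2 * t2 by lra.
have {c20 c21} b3E : b3 = b2 + d2 by lra.
by rewrite /cross_area /strip_area/= k3E b3E k2E b2E; field.
Qed.

Lemma cross_area_middle (l u t1 t2 : R) L1 L2 L2' L3 M :
  cross_area l t1 t2 u L1 L2 L3 M - cross_area l t1 t2 u L1 L2' L3 M =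
  (t2 - t1) * (hom L2' ((t1 + t2) / 2) 1 - hom L2 ((t1 + t2) / 2) 1).
Proof. by rewrite /cross_area /strip_area /hom; field. Qed.

Variables p l u : R.
Hypotheses (p1 : 1 < p) (l0 : 0 <= l) (lu : l < u).

Definition area x := cross_area l (tau p l x) (tau p x u) u
  (tangent p l) (tangent p x) (tangent p u) (chord p l u).

Lemma vol3_breveU x : l < x < u -> vol3 (breveU p l x u) = (area x / 3)%:E.
Proof.
move=> /andP[lx xu]; have x0 : 0 <= x by rewrite (le_trans l0)// ltW.
rewrite breveU_frustum//; apply: vol3_frustum.
- exact/ltW/tau_gt.
- by apply/ltW/(lt_trans (tau_lt _ p1 _ _ l0 lx)); exact: tau_gt.
- exact/ltW/tau_lt.
- by move=> t; exact: first_piece.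
- by move=> t; exact: second_piece.
- by move=> t; exact: third_piece.
Qed.

Lemma area_min_tau x : l < x < u ->
    (forall y, l < y < u -> area x <= area y) ->
  tau p l x + tau p x u = 2 * x.
Proof.
move=> /andP[lx xu] xmin; have x0 : 0 < x by exact: le_lt_trans lx.
have x0' := ltW x0.
have l1 := tau_gt _ p1 _ _ l0 lx; have l2 := tau_lt _ p1 _ _ l0 lx.
have u1 := tau_gt _ p1 _ _ x0' xu; have u2 := tau_lt _ p1 _ _ x0' xu.
set t1 := tau p l x in l1 l2 *; set t2 := tau p x u in u1 u2 *.
(* The competitor: the middle of the middle piece. *)
pose m := (t1 + t2) / 2.
have lm : l < m by rewrite /m; lra.
have mu : m < u by rewrite /m; lra.
have m0 : 0 <= m by rewrite (le_trans l0)// ltW.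
suff mx : m = x by rewrite -mx /m; field.
apply/eqP/negP => /negP mx.
have := xmin m; rewrite lm mu => /(_ isT).
apply/negP; rewrite -ltNge.
have le_m : area m <= cross_area l t1 t2 u (tangent p l) (tangent p m) (tangent p u) (chord p l u).
  rewrite (cross_area_breakpoints _ _ t1 t2 (tau p l m) (tau p m u)
    (dpow p m - dpow p l) (dpow p u - dpow p m)); last 2 first.
  - by move=> t; apply: tangent_cross.
  - by move=> t; apply: tangent_cross.
  rewrite -/(area m) -addrA lerDl.
  by rewrite addr_ge0// mulr_ge0 ?sqr_ge0// divr_ge0// subr_ge0 ltW// dpow_lt.
apply: le_lt_trans le_m _.
rewrite -subr_gt0 cross_area_middle mulr_gt0//.
  by rewrite subr_gt0 (lt_trans l2).
by rewrite -/m tangent_self subr_gt0 tangent_lt.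
Qed.

End Critical.

(** * The four bounds *)

Section Bounds.
Context {R : realType}.
Variables p l u : R.
Hypotheses (p1 : 1 < p) (p2 : p != 2) (l0 : 0 <= l) (lu : l < u).
Let q := p - 1.
Let q0 : 0 < q. Proof. by rewrite subr_gt0. Qed.
Let q1 : q != 1. Proof. by rewrite /q; apply: contra p2 => /eqP ?; apply/eqP; lra. Qed.
Let p0 : 0 < p. Proof. exact: lt_trans p1. Qed.
Let u0 : 0 < u. Proof. exact: le_lt_trans lu. Qed.
Let u0' := ltW u0.
Let powlu : l `^ q < u `^ q.
Proof. by rewrite gt0_ltr_powR// nnegrE ltW. Qed.

Let N := ((u `^ q + l `^ q) / 2) `^ (1 / q).
Let T := q * (u `^ p - l `^ p) / (p * (u `^ q - l `^ q)).
Let m := (u `^ p - l `^ p) / (p * (u - l)).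
Let M := m `^ (1 / q).

Lemma powR_rootK (x : R) : 0 <= x -> (x `^ q) `^ (1 / q) = x.
Proof. by move=> x0; rewrite -powRrM mul1r divff ?gt_eqF// powRr1. Qed.

Lemma rootK_powR (x : R) : 0 <= x -> (x `^ (1 / q)) `^ q = x.
Proof. by move=> x0; rewrite -powRrM mul1r mulVf ?gt_eqF// powRr1. Qed.

Lemma powR_signed (c r x y : R) : 0 < r -> 0 <= x -> 0 <= y ->
  0 < c * (y - x) -> 0 < c * (y `^ r - x `^ r).
Proof.
move=> r0 x0 y0; have [c0|c0|->] := ltgtP c 0; last by rewrite !mul0r ltxx.
- by rewrite !nmulr_rgt0// !subr_lt0 => yx; apply: gt0_ltr_powR.
- by rewrite !pmulr_rgt0// !subr_gt0 => yx; apply: gt0_ltr_powR.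
Qed.

Let m0 : 0 <= m.
Proof.
rewrite /m divr_ge0 ?mulr_ge0 ?subr_ge0 ?(ltW lu) ?(ltW p0)//.
by rewrite ge0_ler_powR ?nnegrE ?(ltW p0)// ltW.
Qed.

Let N0 : 0 < N.
Proof.
rewrite powR_gt0// divr_gt0//.
by rewrite ltr_pwDl ?powR_ge0// powR_gt0.
Qed.

Let NqE : N `^ q = (u `^ q + l `^ q) / 2.
Proof. by rewrite rootK_powR// divr_ge0// addr_ge0 ?powR_ge0. Qed.

(** Scaling by the power mean N makes a^q and b^q symmetric about 1. *)
Lemma powR_mean_lt_tau : 0 < (1 - q) * (T - N).
Proof.
have a0 : 0 <= l / N by rewrite divr_ge0// ltW.
have lN : l < N.
  rewrite -(powR_rootK _ l0); apply: gt0_ltr_powR;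
    rewrite ?nnegrE ?divr_ge0 ?addr_ge0 ?powR_ge0//.
    by rewrite divr_gt0.
  by rewrite ltr_pdivlMr// mulr_natr mulr2n ltrD2r.
have Nu : N < u.
  rewrite -[ltRHS](powR_rootK _ u0'); apply: gt0_ltr_powR;
    rewrite ?nnegrE ?divr_ge0 ?addr_ge0 ?powR_ge0//.
    by rewrite divr_gt0.
  by rewrite ltr_pdivrMr// mulr_natr mulr2n ltrD2l.
have a1 : l / N < 1 by rewrite ltr_pdivrMr// mul1r.
have b1 : 1 < u / N by rewrite ltr_pdivlMr// mul1r.
have := @at1_gap_midpoint R q q0 q1 (l / N) (u / N) a0 a1 b1.
rewrite !powR_divq// -/q NqE.
have s0 : 0 < u `^ q + l `^ q by rewrite ltr_pwDl ?powR_ge0// powR_gt0.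
have -> : l `^ q / ((u `^ q + l `^ q) / 2) + u `^ q / ((u `^ q + l `^ q) / 2) = 2.
  by field; rewrite gt_eqF.
move=> /(_ erefl).
have Np : 0 < N `^ p by exact: powR_gt0.
have d0 : 0 < p * (u `^ q - l `^ q) by rewrite mulr_gt0// subr_gt0.
rewrite -(pmulr_lgt0 _ Np) -mulrA [(at1_gap _ _ - _) * _]mulrBl !at1_gap_scale// -/q => H.
rewrite -(pmulr_lgt0 _ d0); move: H; congr (0 < _).
rewrite -[in RHS]mulrA [(T - N) * _]mulrBl /T divfK ?gt_eqF//; ring.
Qed.

(** Scaling by the arithmetic mean makes a and b symmetric about 1. *)
Lemma secant_power_lt_mid : 0 < (1 - q) * ((u + l) / 2 - M).
Proof.
set c := (u + l) / 2; have c0 : 0 < c by rewrite divr_gt0// ltr_pwDl.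
have a0 : 0 <= l / c by rewrite divr_ge0// ltW.
have a1 : l / c < 1.
  by rewrite ltr_pdivrMr// mul1r ltr_pdivlMr// mulr_natr mulr2n ltrD2r.
have b1 : 1 < u / c.
  by rewrite ltr_pdivlMr// mul1r ltr_pdivrMr// mulr_natr mulr2n ltrD2l.
have := @tan1_gap_midpoint R q q0 q1 (l / c) (u / c) a0 a1 b1.
have -> : l / c + u / c = 2 by rewrite /c; field; rewrite gt_eqF// ltr_pwDl.
move=> /(_ erefl).
have cp : 0 < c `^ p by exact: powR_gt0.
have d0 : 0 < p * (u - l) by rewrite mulr_gt0// subr_gt0.
rewrite -(pmulr_lgt0 _ cp) -mulrA [(tan1_gap _ _ - _) * _]mulrBl !tan1_gap_scale// -/q => H.
have {}H : 0 < (1 - q) * (c `^ q - m).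
  rewrite -(pmulr_lgt0 _ d0); move: H; congr (0 < _).
  rewrite -[in RHS]mulrA [(c `^ q - m) * _]mulrBl /m divfK ?gt_eqF//; ring.
rewrite -[c](powR_rootK _ (ltW c0)); apply: powR_signed => //.
  by rewrite divr_gt0.
exact: powR_ge0.
Qed.

Section crit.
Variable x : R.
Hypotheses (lx : l < x) (xu : x < u).
Hypothesis crit : tau p l x + tau p x u = 2 * x.
Let x0 : 0 < x. Proof. exact: le_lt_trans lx. Qed.
Let a0 : 0 <= l / x. Proof. by rewrite divr_ge0// ltW. Qed.
Let a1 : l / x < 1. Proof. by rewrite ltr_pdivrMr// mul1r. Qed.
Let b1 : 1 < u / x. Proof. by rewrite ltr_pdivlMr// mul1r. Qed.
Let xp : 0 < x `^ p. Proof. exact: powR_gt0. Qed.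
Let xq : 0 < x `^ q. Proof. exact: powR_gt0. Qed.

Let lxq : l `^ q < x `^ q.
Proof. by rewrite gt0_ltr_powR// nnegrE// ltW. Qed.
Let xuq : x `^ q < u `^ q.
Proof. by rewrite gt0_ltr_powR// nnegrE// ltW. Qed.

(** The stationarity equation scaled by x: the crossing points are symmetric
    about 1. *)
Lemma crit_at1_gap :
  at1_gap q (l / x) * ((u / x) `^ q - 1) = at1_gap q (u / x) * (1 - (l / x) `^ q).
Proof.
apply: (mulIf (lt0r_neq0 xp)).
rewrite [LHS]mulrAC [RHS]mulrAC !at1_gap_scale// -/q !powR_divq// -/q.
have tauE a b : a `^ q < b `^ q ->
    tau p a b * (p * (b `^ q - a `^ q)) =
    (p * b `^ q * b - b `^ p) - (p * a `^ q * a - a `^ p).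
  move=> ab; rewrite /tau /dpow -/q; field.
  by rewrite -mulrBr mulf_eq0 gt_eqF//= subr_eq0 lt_eqF.
have {}tauE a b : 0 <= a -> 0 <= b -> a `^ q < b `^ q ->
    tau p a b * (p * (b `^ q - a `^ q)) = q * (b `^ p - a `^ p).
  move=> a0' b0' /tauE ->; rewrite (powR_split _ p1 a)// (powR_split _ p1 b)// -/q.
  have -> : p = q + 1 by rewrite /q subrK.
  ring.
have t1E := tauE _ _ l0 (ltW x0) lxq; have t2E := tauE _ _ (ltW x0) u0' xuq.
have xpE : x `^ p = x * x `^ q by rewrite powR_split// ltW.
move: crit t1E t2E; rewrite xpE; have pE : p = q + 1 by rewrite /q subrK.
set t1 := tau p l x; set t2 := tau p x u.
have Xn := lt0r_neq0 xq; move: Xn.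
set X := x `^ q; set L := l `^ q; set U := u `^ q; set lp := l `^ p; set up := u `^ p.
move=> Xn c t1E t2E.
suff e : (q * lp - p * L * x + x * X) * (U - X) = (q * up - p * U * x + x * X) * (X - L).
  rewrite (_ : U / X - 1 = (U - X) / X); last by field.
  rewrite (_ : 1 - L / X = (X - L) / X); last by field.
  by rewrite [LHS]mulrA [RHS]mulrA e.
have t2D : t2 = 2 * x - t1 by rewrite -c addrAC subrr add0r.
have e1 : q * lp = q * (x * X) - t1 * (p * (X - L)) by rewrite t1E; ring.
have e2 : q * up = q * (x * X) + (2 * x - t1) * (p * (U - X)) by rewrite -t2D t2E; ring.
by rewrite e1 e2 pE; ring.
Qed.

(** Whichever of the tangents at l and at u has the smaller gap at x tells on
    which side of their crossing point T the point x lies. *)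
Lemma tau_lt_crit : 0 < (1 - q) * (x - T).
Proof.
have := critical_at1_gap _ q0 q1 _ _ a0 a1 b1 crit_at1_gap.
have d0 : 0 < p * (u `^ q - l `^ q) by rewrite mulr_gt0// subr_gt0.
rewrite -(pmulr_lgt0 _ xp) -mulrA [(at1_gap _ _ - _) * _]mulrBl !at1_gap_scale// -/q => H.
rewrite -(pmulr_lgt0 _ d0); move: H; congr (0 < _).
rewrite -[in RHS]mulrA [(x - T) * _]mulrBl /T divfK ?gt_eqF//; ring.
Qed.

(** The tangent at x has equal gaps at l and at u exactly when it is parallel to
    the chord, and M is the point where the tangent has this slope. *)
Lemma crit_lt_secant_power : 0 < (1 - q) * (M - x).
Proof.
have := critical_tan1_gap _ q0 q1 _ _ a0 a1 b1 crit_at1_gap.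
have d0 : 0 < p * (u - l) by rewrite mulr_gt0// subr_gt0.
rewrite -(pmulr_lgt0 _ xp) -mulrA [(tan1_gap _ _ - _) * _]mulrBl !tan1_gap_scale// -/q => H.
have {}H : 0 < (1 - q) * (m - x `^ q).
  rewrite -(pmulr_lgt0 _ d0); move: H; congr (0 < _).
  rewrite -[in RHS]mulrA [(m - _) * _]mulrBl /m divfK ?gt_eqF//; ring.
rewrite -(powR_rootK _ (ltW x0)); apply: powR_signed => //.
  by rewrite divr_gt0.
exact: ltW.
Qed.

End crit.
End Bounds.

(** * The theorem *)

Lemma tau_square (R : realType) (a b : R) : 0 <= a -> a < b ->
  tau 2 a b = (a + b) / 2.
Proof.
move=> a0 ab; have b0 : 0 <= b by rewrite (le_trans a0)// ltW.
rewrite /tau /dpow (_ : 2 - 1 = 1 :> R) ?powRr1// -?(powR_mulrn 2)//; last by ring.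
rewrite (powR_mulrn 2)// (powR_mulrn 2)//; field.
by rewrite -mulrBr mulf_eq0 gt_eqF//= subr_eq0 lt_eqF.
Qed.

Theorem theorem3p18 (R : realType) (l u p xi1 : R)
    (hl : 0 <= l) (hlu : l < u) (hp : 1 < p)
    (hxi1 : l < xi1 < u)
    (hmin : forall xi : R, l < xi < u ->
       (vol3 (breveU p l xi1 u) <= vol3 (breveU p l xi u))%E) :
  [/\ p = 2 -> xi1 = (u + l) / 2,
      1 < p < 2 ->
        [/\ ((u `^ (p - 1) + l `^ (p - 1)) / 2) `^ (1 / (p - 1)) <
              (p - 1) * (u `^ p - l `^ p) / (p * (u `^ (p - 1) - l `^ (p - 1))),
            (p - 1) * (u `^ p - l `^ p) / (p * (u `^ (p - 1) - l `^ (p - 1))) <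
              xi1,
            xi1 < ((u `^ p - l `^ p) / (p * (u - l))) `^ (1 / (p - 1))
          & ((u `^ p - l `^ p) / (p * (u - l))) `^ (1 / (p - 1)) <
              (u + l) / 2]
    & 2 < p ->
        [/\ ((u `^ (p - 1) + l `^ (p - 1)) / 2) `^ (1 / (p - 1)) >
              (p - 1) * (u `^ p - l `^ p) / (p * (u `^ (p - 1) - l `^ (p - 1))),
            (p - 1) * (u `^ p - l `^ p) / (p * (u `^ (p - 1) - l `^ (p - 1))) >
              xi1,
            xi1 > ((u `^ p - l `^ p) / (p * (u - l))) `^ (1 / (p - 1))
          & ((u `^ p - l `^ p) / (p * (u - l))) `^ (1 / (p - 1)) >
              (u + l) / 2] ].
Proof.
have /andP[lx xu] := hxi1.
have x0 : 0 <= xi1 by rewrite (le_trans hl)// ltW.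
have crit : tau p l xi1 + tau p xi1 u = 2 * xi1.
  apply: area_min_tau => // y ly; have := hmin y ly.
  by rewrite !vol3_breveU// lee_fin ler_pM2r// invr_gt0.
have q2 : 1 - (p - 1) = 2 - p by ring.
split.
- move=> p2; move: crit; rewrite p2 !tau_square// => c.
  by lra.
- move=> /andP[_ p2].
  have pn : p != 2 by rewrite lt_eqF.
  have := powR_mean_lt_tau p l u hp pn hl hlu.
  have := tau_lt_crit p l u hp pn hl hlu xi1 lx xu crit.
  have := crit_lt_secant_power p l u hp pn hl hlu xi1 lx xu crit.
  have := secant_power_lt_mid p l u hp pn hl hlu.
  by rewrite q2 !pmulr_rgt0 ?subr_gt0.
- move=> p2.
  have pn : p != 2 by rewrite gt_eqF.
  have := powR_mean_lt_tau p l u hp pn hl hlu.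
  have := tau_lt_crit p l u hp pn hl hlu xi1 lx xu crit.
  have := crit_lt_secant_power p l u hp pn hl hlu xi1 lx xu crit.
  have := secant_power_lt_mid p l u hp pn hl hlu.
  by rewrite q2 !nmulr_rgt0 ?subr_lt0.
Qed.
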